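(* Let a filtration $\{\mathcal F_n\}$ on a measurable space $(\Omega,\mathcal F)$ satisfy condition A, with generating sets $A^n_s$ and index sets $I^n_s$, and let $M$ be a convex set of equivalent measures on this measurable space. Suppose that $$P(A^n_s)>0,\qquad P\in M,\ s=1,2,\dots,\ n=1,2,\dots,$$ and that for a certain measure $P_{i_0}\in M$ the inequalities $$\frac{P(A^{n+1}_j)}{P(A^n_s)}\le\frac{P_{i_0}(A^{n+1}_j)}{P_{i_0}(A^n_s)},\qquad j\in I^n_s,\quad A^n_s=\bigcup_{j\in I^n_s}A^{n+1}_j,\quad s,n=1,2,\dots,\quad P\in M,$$ are valid. Let $\{f_m\}_{m=0}^\infty$ be a nonnegative supermartingale relative to $M$ which is uniformly integrable relative to the measures from $M$. Then $\{f_m\}_{m=0}^\infty$ is a local regular supermartingale if and only if it belongs to the set $K$ (defined in the context).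
   Context: $(\Omega,\mathcal F)$ is a measurable space with a filtration $\mathcal F_m\subset\mathcal F_{m+1}\subset\mathcal F$, $m\ge0$, and $\mathcal F_0=\{\emptyset,\Omega\}$. All measures are probability measures; equivalent means mutually absolutely continuous. $E^P$ denotes (conditional) expectation with respect to $P$; relations between random variables hold almost surely. $N_0$ is the set of positive integers. Condition A on the filtration: 1) $\mathcal F$ is the minimal $\sigma$-algebra generated by $\bigcup_{n=0}^\infty\mathcal F_n$; 2) for $n\ge1$, $\mathcal F_n$ is generated by sets $A^n_s\in\mathcal F$, $s=1,2,\dots$, with $A^n_m\cap A^n_j=\emptyset$ for $m\ne j$, $\bigcup_{s=1}^\infty A^n_s=\Omega$, and $A^n_s=\bigcup_{j\in I^n_s}A^{n+1}_j$, where $I^n_s\cap I^n_m=\emptyset$ for $s\ne m$ and $\bigcup_{s=1}^\infty I^n_s=N_0$. The set $K$. Let $G_0=\{\xi\ge0:\ E^P\xi=1,\ P\in M\}$. Let $F_0$ be the set of adapted processes $f=\{f_m\}_{m=0}^\infty$ with $P(|f_m|<\infty)=1$, $P\in M$, and $f_m\le f_{m-1}$, $m\ge1$. For $\xi\in G_0$ let $L_\xi$ be the set of adapted processes $\bar f=\{f_mE^P\{\xi|\mathcal F_m\}\}_{m=0}^\infty$ ($P\in M$) with $\{f_m\}_{m=0}^\infty\in F_0$ and $E^Q\xi|f_m|<\infty$ for all $Q\in M$, $m\ge1$. Let $V=\bigcup_{\xi\in G_0}L_\xi$ and $$K=\Big\{\sum_{i=1}^mC_i\bar f_i:\ \bar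 f_i\in V,\ C_i\ge0,\ i=1,\dots,m,\ m=1,2,\dots\Big\}.$$ An adapted process $\{f_m\}_{m=0}^\infty$ is a supermartingale relative to a family of measures $M$ if $E^P|f_m|<\infty$ for $m\ge1$, $P\in M$, and $E^P\{f_m|\mathcal F_k\}\le f_k$ for $0\le k\le m$, $P\in M$. Sets of adapted non-decreasing processes starting at $0$ are partially ordered by: $g_1\preceq g_2$ iff $P(g^2_m-g^1_m\ge0)=1$ for all $m\ge1$, where $g_i=\{g^i_m\}$; (maximal) chains and maximal elements refer to $\preceq$. Regular supermartingale. Let $\{f_m,\mathcal F_m\}_{m=0}^\infty$ be a supermartingale relative to a convex set of equivalent measures $M$ such that $|f_m|\le\varphi$ for all $m\ge0$ and $E^Q\varphi<T<\infty$ for all $Q\in M$, with a random variable $\varphi$ and a real number $T$ not depending on $Q\in M$. It is called regular if there exists an adapted nonnegative process $\bar g^0=\{\bar g^0_m\}_{m=0}^\infty$, $\bar g^0_0=0$, $E^P\bar g^0_m<\infty$ ($m\ge1$, $P\in M$), such that for every finite family $\hat P_1,\dots,\hat P_s\in M$ satisfying $0<l\le\frac{d\hat P_i}{d\hat P_j}\le L<\infty$, $i,j=1,\dots,s$ (with $l,L$ real numbers depending on the family), the following hold. Put $\hat M_s=\{\sum_{i=1}^s\gamma_i\hat P_i:\gamma_i\ge0,\sum_{i=1}^s\gamma_i=1\}$ and let $G_s$ (for $s\ge1$) be the set of adapted non-decreasing processes $\{g_m\}_{m=0}^\infty$, $g_0=0$, for which $\{f_m+g_m\}_{m=0}^\infty$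 is a supermartingale relative to all measures from $\hat M_s$. (i) There exist a natural number $1\le m_0<\infty$ and an $\mathcal F_{m_0-1}$-measurable nonnegative random variable $\varphi^s_{m_0}$ with $\hat P_1(\varphi^s_{m_0}>0)>0$ such that $f_{m_0-1}-E^{\hat P_i}\{f_{m_0}|\mathcal F_{m_0-1}\}\ge\varphi^s_{m_0}$, $i=1,\dots,s$. (ii) For the maximal element $g^s=\{g^s_m\}_{m=0}^\infty$ in a certain maximal chain $\tilde G_s\subseteq G_s$, $E^{\hat P_i}\{f_m+g^s_m|\mathcal F_k\}=f_k+g^s_k$ for $0\le k\le m$, $m\ge1$, $i=1,\dots,s$. (iii) $E^{\hat P_i}\{g^s_m-g^s_{m-1}|\mathcal F_{m-1}\}=E^{\hat P_i}\{\bar g^0_m|\mathcal F_{m-1}\}$ for $m\ge1$, $i=1,\dots,s$. Local regular supermartingale. A supermartingale $\{f_m,\mathcal F_m\}_{m=0}^\infty$ relative to $M$ with $\sup_{P\in M}E^P|f_m|<\infty$ for all $m\ge0$ is called local regular if there exists an increasing sequence of nonrandom stopping times $\tau_{k_s}=k_s<\infty$, $s=1,2,\dots$, $\lim_{s\to\infty}k_s=\infty$, such that for every $s$ the stopped process $\{f_{m\wedge\tau_{k_s}},\mathcal F_m\}_{m=0}^\infty$ is a regular supermartingale. Uniform integrability relative to the measures from $M$ means uniform integrability with respect to each $P\in M$.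
   Formalization: The formal theorem additionally assumes that the supermartingale is not a martingale relative to all measures of M; otherwise the claim fails, since f_m = 1 belongs to K but condition (i) of regularity excludes every martingale. *)

(* Defs.v *)
From HB Require Import structures.
From mathcomp Require Import all_boot all_order all_algebra.
From mathcomp Require Import all_classical all_reals all_analysis.

Set Implicit Arguments.
Unset Strict Implicit.
Unset Printing Implicit Defensive.

Import Order.TTheory GRing.Theory Num.Theory.
Import numFieldNormedType.Exports.

Local Open Scope classical_set_scope.
Local Open Scope ring_scope.

(* Random variables are real-valued functions; sub-sigma-algebras of the
   measurable sets of T are sets of sets; a process is f : nat -> T -> R.
   A family of measures is a set of probabilities.  Since a [probability] is
   a function on all sets, linear relations between measures are only imposed
   on measurable sets. *)

Section filtrations.
Context d (T : measurableType d).
Implicit Types (FF : nat -> set (set T)) (A : nat -> nat -> set T)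
  (I : nat -> nat -> set nat).

Definition filtration FF :=
  [/\ forall n, sigma_algebra setT (FF n),
      forall n, FF n `<=` FF n.+1,
      forall n, FF n `<=` measurable &
      FF 0%N = [set set0; setT]].

(* The positive integers that index the generating sets are renumbered from
   0; the time index n is not, and nothing is asked of A and I at n = 0. *)
Definition condition_A FF A I :=
  (measurable : set (set T)) = <<s \bigcup_n FF n >> /\
  forall n, (0 < n)%N ->
    [/\ (forall s, measurable (A n s)) /\ FF n = <<s range (A n) >>,
        (forall m j, m != j -> A n m `&` A n j = set0),
        \bigcup_s A n s = setT,
        (forall s, A n s = \bigcup_(j in I n s) A n.+1 j) &
        (forall s m, s != m -> I n s `&` I n m = set0) /\
        \bigcup_s I n s = setT].

End filtrations.

Section families_of_measures.
Context d (T : measurableType d) (R : realType).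
Implicit Types (P Q : probability T R) (M : set (probability T R)).

Definition convex_family M := forall P Q (t : R), M P -> M Q -> 0 <= t <= 1 ->
  exists2 S : probability T R, M S & forall B, measurable B ->
    (S B = t%:E * P B + (1 - t)%:E * Q B)%E.

Definition equivalent_family M := forall P Q, M P -> M Q -> P `<< Q.

Definition mixtures s (Ph : 'I_s -> probability T R) : set (probability T R) :=
  [set Q | exists gam : 'I_s -> R,
    [/\ forall i, 0 <= gam i, \sum_(i < s) gam i = 1 &
        forall B, measurable B -> Q B = (\sum_(i < s) (gam i)%:E * Ph i B)%E]].

(* The densities are those of the measures on the whole sigma-algebra. *)
Definition density_bounded s (Ph : 'I_s -> probability T R) :=
  exists l L : R, 0 < l /\ forall i j, {ae Ph j, forall x,
    (l%:E <= Radon_Nikodym (charge_of_finite_measure (Ph i)) (Ph j) x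
          <= L%:E)%E}.

Definition all_as M (B : T -> Prop) :=
  forall P, M P -> {ae P, forall x, B x}.

End families_of_measures.

Section conditional_expectation.
Context d (T : measurableType d) (R : realType).
Implicit Types (P : probability T R) (G : set (set T)) (X Y : T -> R).

Definition measurable_wrt G X :=
  measurable_fun [set: g_sigma_algebraType G] (X : g_sigma_algebraType G -> R).

Definition is_condexp P G X Y :=
  [/\ measurable_wrt G Y, P.-integrable setT (EFin \o Y) &
      forall B, G B ->
        (\int[P]_(x in B) (Y x)%:E = \int[P]_(x in B) (X x)%:E)%E].

(* A version of the conditional expectation of X given the sigma-algebra G.
   The default value 0 is irrelevant for P-integrable X, for which a version
   exists; only such X occur below. *)
Definition condexp P G X : T -> R := xget (cst 0) [set Y | is_condexp P G X Y].

End conditional_expectation.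

Section supermartingales.
Context d (T : measurableType d) (R : realType).
Variable FF : nat -> set (set T).
Implicit Types (P Q : probability T R) (M : set (probability T R)).
Implicit Types (f g h : nat -> T -> R) (xi : T -> R).

Definition adapted f := forall m, measurable_wrt (FF m) (f m).

Definition supermartingale M f :=
  [/\ adapted f,
      forall P m, M P -> (0 < m)%N -> ('E_P[fun x => `|f m x|%R] < +oo)%E &
      forall P k m, M P -> (k <= m)%N ->
        {ae P, forall x, condexp P (FF k) (f m) x <= f k x}].

Definition martingale M f :=
  [/\ adapted f,
      forall P m, M P -> (0 < m)%N -> ('E_P[fun x => `|f m x|%R] < +oo)%E &
      forall P k m, M P -> (k <= m)%N ->
        {ae P, forall x, condexp P (FF k) (f m) x = f k x}].

Definition uniformly_integrable P f :=
  ereal_sup (range (fun m =>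
      (\int[P]_(x in [set x | (c < `|f m x|)%R]) (`|f m x|%R)%:E)%E))
    @[c --> +oo%R] --> 0%E.

Definition process_le M g1 g2 := forall P m, M P -> (0 < m)%N ->
  P [set x | 0 <= g2 m x - g1 m x] = 1%E.

Definition maximal_chain M (G C : set (nat -> T -> R)) :=
  [/\ C `<=` G, total_on C (process_le M) &
      forall D, D `<=` G -> total_on D (process_le M) -> C `<=` D -> D = C].

Definition maximal_element M (C : set (nat -> T -> R)) g :=
  C g /\ forall h, C h -> process_le M g h -> process_le M h g.

(* The set G_s for the family Ph. *)
Definition compensators M s (Ph : 'I_s -> probability T R) f :
    set (nat -> T -> R) :=
  [set g | [/\ adapted g,
               all_as M (fun x => g 0%N x = 0),
               (forall m, all_as M (fun x => g m x <= g m.+1 x)) &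
               supermartingale (mixtures Ph) (fun m x => f m x + g m x)]].

Definition uniformly_dominated M f := exists (phi : T -> R) (t : R),
  [/\ measurable_fun setT phi,
      forall m, all_as M (fun x => `|f m x| <= phi x) &
      forall Q, M Q -> ('E_Q[phi] < t%:E)%E].

(* The existence of m0 and phi means that f is not a martingale relative to
   any of the measures Ph i: in particular a martingale, such as a constant
   process, is neither regular nor local regular. *)
Definition regular M f :=
  [/\ supermartingale M f, uniformly_dominated M f &
  exists gbar : nat -> T -> R,
  [/\ adapted gbar,
      forall m, all_as M (fun x => 0 <= gbar m x),
      all_as M (fun x => gbar 0%N x = 0),
      forall P m, M P -> (0 < m)%N -> ('E_P[gbar m] < +oo)%E &
  forall (s : nat) (Ph : 'I_s.+1 -> probability T R),
    (forall i, M (Ph i)) -> density_bounded Ph ->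
    (exists (m0 : nat) (phi : T -> R),
      [/\ (0 < m0)%N, measurable_wrt (FF m0.-1) phi,
          all_as M (fun x => 0 <= phi x),
          (0 < Ph ord0 [set x | 0 < phi x]%R)%E &
          forall i, {ae Ph i, forall x,
            phi x <= f m0.-1 x - condexp (Ph i) (FF m0.-1) (f m0) x}]) /\
    (exists (C : set (nat -> T -> R)) (g : nat -> T -> R),
      [/\ maximal_chain M (compensators M Ph f) C,
          maximal_element M C g,
          forall i k m, (0 < m)%N -> (k <= m)%N -> {ae Ph i, forall x,
            condexp (Ph i) (FF k) (fun y => f m y + g m y) x
              = f k x + g k x} &
          forall i m, (0 < m)%N -> {ae Ph i, forall x,
            condexp (Ph i) (FF m.-1) (fun y => g m y - g m.-1 y) x
              = condexp (Ph i) (FF m.-1) (gbar m) x}])]].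

Definition stopped f (k : nat) : nat -> T -> R := fun m => f (minn m k).

Definition local_regular M f :=
  [/\ supermartingale M f,
      forall m, (ereal_sup [set 'E_P[fun x => (`|f m x|)%R] | P in M] < +oo)%E &
      exists k : nat -> nat,
        [/\ increasing_seq k, k @ \oo --> \oo &
            forall s, regular M (stopped f (k s))]].

Definition G0 M : set (T -> R) :=
  [set xi : T -> R | [/\ measurable_fun setT xi, all_as M (fun x => 0 <= xi x) &
                forall P, M P -> ('E_P[xi] = 1)%E]].

(* Finiteness of f_m is built into real-valued random variables. *)
Definition F0 M : set (nat -> T -> R) :=
  [set f | adapted f /\ forall m, all_as M (fun x => f m.+1 x <= f m x)].

(* h = f_m E^P{xi | F_m} is required for every P in M, so that the process
   does not depend on P. *)
Definition L_ M xi : set (nat -> T -> R) :=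
  [set h | adapted h /\ exists2 f, F0 M f &
    (forall Q m, M Q -> (0 < m)%N ->
       ('E_Q[fun x => (xi x * `|f m x|)%R] < +oo)%E) /\
    (forall P m, M P ->
       {ae P, forall x, h m x = f m x * condexp P (FF m) xi x})].

Definition V_ M : set (nat -> T -> R) := \bigcup_(xi in G0 M) L_ M xi.

Definition K_ M : set (nat -> T -> R) :=
  [set f | adapted f /\
    exists (n : nat) (C : 'I_n -> R) (h : 'I_n -> nat -> T -> R),
    [/\ (0 < n)%N, forall i, 0 <= C i, forall i, V_ M (h i) &
        forall m, all_as M (fun x => f m x = \sum_(i < n) C i * h i m x)]].

End supermartingales.

(* Main.v *)
Require Import Defs.
From HB Require Import structures.
From mathcomp Require Import all_boot all_order all_algebra.
From mathcomp Require Import all_classical all_reals all_analysis.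
From mathcomp Require Import measurable_realfun.

Set Implicit Arguments.
Unset Strict Implicit.
Unset Printing Implicit Defensive.

Import Order.TTheory GRing.Theory Num.Theory.
Import numFieldNormedType.Exports.

Local Open Scope classical_set_scope.
Local Open Scope ring_scope.

(** For fixed n and s, both sides of the inequalities between ratios sum to 1
    over the j in I n s; hence they are equalities, and all measures of M have
    the same conditional law given F_1 ([one_step_law],
    [proportional_on_first_cell]): they only differ by the weights of the sets
    A 1 s. Each F_n is moreover generated by a countable partition all of whose
    blocks are charged by every measure of M. So an F_n-measurable function is
    constant on the blocks, almost sure relations between such functions hold
    everywhere ([ae_everywhere]), a conditional expectation is an average over
    blocks and is unique as a function ([condexp_unique]), and for k >= 1 the
    conditional expectation given F_k is the same for all measures of M
    ([condexp_transfer]).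

    Consequently only the first step can tell the measures of M apart, and for
    an f that is not a martingale both properties amount to one condition on
    that step ([first_compensator]): there is an F_1-measurable g >= 0 with
    E^P f_1 + E^P g = f_0 for all P in M. Given such a g, put S_1 = g and add at
    the later steps m the Doob increments f_(m-1) - E{f_m | F_(m-1)}, which do
    not depend on P: then N = f + S is a martingale relative to every P in M
    ([compensated_martingale]).

    Both properties give g. If f is local regular, g is the first term of the
    process of a regular stopped process, tested on families of one measure. If
    f is a combination of products f^i_m E{xi_i | F_m} with coefficients C_i,
    take g = (sum of the C_i f^i_0 E{xi_i | F_1}) - f_1, which is nonnegative
    because f^i decreases.

    From g to local regularity: as f is not a martingale, some increment of S is
    positive somewhere, hence on a block which every measure charges. Stop f at
    that time or later. The stopped S is then the common compensator of every
    finite family ([regular_stopped]); it is maximal in any chain that contains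
    it, since a larger compensator would have the same expectation.

    From g to K: f = N - S, where - S is a nonincreasing process and goes with
    the density 1. It remains to write N_m = E{zeta | F_m}. As f is uniformly
    integrable, the limits of the integrals of f_n over B along an ultrafilter
    form a measure in B with a density r ([limit_density]), and zeta is the sum
    of r and of the limit of S. *)

(** * Sigma-algebras generated by an integer-valued function *)
Section index_sigma_algebra.
Context d (T : measurableType d) (R : realType).
Implicit Types (i : T -> nat) (P : probability T R) (X Y : T -> R).
Implicit Types (B : set T) (x y : T).

(** The sigma-algebra generated by a countable partition, given by the function
    [i] that numbers the blocks; all its sets are unions of blocks, without any
    closure operation. *)
Definition index_sets i : set (set T) := range (preimage i).

Definition cell i x : set T := i @^-1` [set i x].

Lemma index_sets_cell i x : index_sets i (cell i x).
Proof. by exists [set i x]. Qed.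

Lemma cell_sub i B x : index_sets i B -> B x -> cell i x `<=` B.
Proof. by move=> [D _ <-] Dx y; rewrite /cell /preimage /= => ->. Qed.

Lemma index_sets_invariant i (S : T -> Prop) :
  (forall x y, i x = i y -> S x -> S y) -> index_sets i [set x | S x].
Proof.
move=> Si; exists [set n | exists2 x, i x = n & S x] => //.
by apply/seteqP; split=> [x [y yx Sy]|x Sx]; [exact: Si Sy|exists x].
Qed.

Lemma index_setsI i B1 B2 :
  index_sets i B1 -> index_sets i B2 -> index_sets i (B1 `&` B2).
Proof. by move=> [D1 _ <-] [D2 _ <-]; exists (D1 `&` D2). Qed.

Lemma sigma_algebra_index_sets i : sigma_algebra setT (index_sets i).
Proof.
split; first by exists set0 => //; rewrite preimage_set0.
  by move=> B [D _ <-]; exists (~` D) => //; rewrite setTD.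
move=> F /(_ _)/cid2-/all_sig2[D _ DF].
exists (\bigcup_n D n) => //; rewrite preimage_bigcup.
by apply: eq_bigcupr => n _.
Qed.

(** Every set of values pulls back to a union of blocks, so measurability is
    plain invariance, which every pointwise operation preserves. *)
Lemma measurable_wrt_indexP i Y : measurable_wrt (index_sets i) Y <->
  forall x y, i x = i y -> Y x = Y y.
Proof.
have sG : <<s index_sets i >> = index_sets i.
  exact/sigma_algebra_id/sigma_algebra_index_sets.
split=> [mY x y ixy|Yc _ B mB].
  have := mY measurableT [set Y x] (measurable_set1 _).
  rewrite setTI /measurable /= sG => -[D _ DY].
  have : (i @^-1` D) x by rewrite DY.
  by rewrite /preimage /= ixy => Dy; have : (i @^-1` D) y by []; rewrite DY.
rewrite setTI /measurable /= sG.
by apply: index_sets_invariant => x y /Yc ->.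
Qed.

Definition charges_cells i P := forall x, (0 < P (cell i x))%E.

Section one_index.
Variable i : T -> nat.
Hypothesis mi : index_sets i `<=` measurable.

Lemma measurable_cell x : measurable (cell i x).
Proof. exact/mi/index_sets_cell. Qed.

Lemma measurable_wrt_fun Y : measurable_wrt (index_sets i) Y ->
  measurable_fun setT Y.
Proof.
move=> mY _ B mB; apply: mi; have := mY measurableT B mB.
by rewrite /measurable /= (sigma_algebra_id (sigma_algebra_index_sets i)).
Qed.

Lemma integral_cell P Y x : measurable_wrt (index_sets i) Y ->
  (\int[P]_(y in cell i x) (Y y)%:E = (Y x)%:E * P (cell i x))%E.
Proof.
move=> /measurable_wrt_indexP Yc; rewrite -integral_cst;
  last exact: measurable_cell.
by apply: eq_integral => y; rewrite inE => /Yc ->.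
Qed.

Lemma index_sets_decomp B : index_sets i B ->
  [/\ forall s, measurable (B `&` i @^-1` [set s]),
      trivIset setT (fun s => B `&` i @^-1` [set s]) &
      B = \bigcup_s (B `&` i @^-1` [set s])].
Proof.
move=> GB; split.
- by move=> s; apply: mi; apply: index_setsI => //; exists [set s].
- apply/trivIsetP => s t _ _ st; apply/seteqP; split=>
    // x [[_ /= xs] [_ /= xt]].
  by move: st; rewrite -xs xt eqxx.
- by apply/seteqP; split=> [x Bx|x [s _ []//]]; exists (i x).
Qed.

Lemma index_set_slice B s : index_sets i B ->
  B `&` i @^-1` [set s] = set0 \/
  exists2 x, B x & B `&` i @^-1` [set s] = cell i x.
Proof.
move=> GB; have [->|/set0P[x [Bx /= xs]]] :=
  eqVneq (B `&` i @^-1` [set s]) set0.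
  by left.
right; exists x => //; rewrite /cell xs setIidr// -xs.
exact: cell_sub.
Qed.

(** A set of the sigma-algebra is a countable disjoint union of blocks. *)
Lemma eq_ge0_integral_index_sets P X Y :
  measurable_fun setT X -> measurable_fun setT Y ->
  (forall x, 0 <= X x) -> (forall x, 0 <= Y x) ->
  (forall x, \int[P]_(y in cell i x) (X y)%:E
           = \int[P]_(y in cell i x) (Y y)%:E)%E ->
  forall B, index_sets i B ->
    (\int[P]_(y in B) (X y)%:E = \int[P]_(y in B) (Y y)%:E)%E.
Proof.
move=> mX mY X0 Y0 XY B GB; have [mB tB ->] := index_sets_decomp GB.
rewrite !ge0_integral_bigcup//; last 4 first.
- exact/measurable_EFinP/measurable_funTS.
- by move=> x _; rewrite lee_fin.
- exact/measurable_EFinP/measurable_funTS.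
- by move=> x _; rewrite lee_fin.
apply: eq_eseriesr => s _.
by have [->|[x _ ->]] := index_set_slice s GB; rewrite ?integral_set0.
Qed.

Section one_measure.
Variable P : probability T R.
Hypothesis hP : charges_cells i P.

Lemma cell_massE x : P (cell i x) = (fine (P (cell i x)))%:E.
Proof. by rewrite fineK// fin_num_measure//; exact: measurable_cell. Qed.

Lemma cell_mass_gt0 x : 0 < fine (P (cell i x)).
Proof. by rewrite -lte_fin -cell_massE. Qed.

(** The exceptional set is a union of blocks, and a nonempty one would have
    positive probability. *)
Lemma ae_everywhere (S : T -> Prop) :
  (forall x y, i x = i y -> S x -> S y) ->
  {ae P, forall x, S x} -> forall x, S x.
Proof.
move=> Si [N [mN N0 SN]] x; apply: contrapT => nSx.
have : (P (cell i x) <= P N)%E.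
  apply: le_measure; rewrite ?inE//; first exact: measurable_cell.
  by move=> y yx; apply: SN => /= Sy; apply: nSx; exact: Si Sy.
by rewrite N0 leNgt hP.
Qed.

Lemma sure_everywhere (S : T -> Prop) :
  (forall x y, i x = i y -> S x -> S y) ->
  P [set x | S x] = 1%E -> forall x, S x.
Proof.
move=> Si PS; apply: (ae_everywhere Si).
have mS : measurable [set x | S x] by exact/mi/index_sets_invariant.
exists (~` [set x | S x]); split => //; first exact: measurableC.
by rewrite probability_setC// PS subee.
Qed.

(** Two versions are constant on each block and have the same integral there, so
    they agree at every point and not just almost surely. *)
Lemma condexp_unique X Y : is_condexp P (index_sets i) X Y ->
  condexp P (index_sets i) X = Y.
Proof.
rewrite /condexp => XY; case: xgetP => [Z _ XZ|/(_ Y)//].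
apply/funext => x; have [mY _ /(_ _ (index_sets_cell i x))] := XY.
have [mZ _ /(_ _ (index_sets_cell i x))<-] := XZ.
rewrite !integral_cell// cell_massE -!EFinM => -[] XYx.
by apply/esym/(mulIf _ XYx)/lt0r_neq0/cell_mass_gt0.
Qed.

(** The function that averages X over the block of a point is a version of the
    conditional expectation. *)
Lemma condexpP X : P.-integrable setT (EFin \o X) -> (forall x, 0 <= X x) ->
  is_condexp P (index_sets i) X (condexp P (index_sets i) X).
Proof.
move=> iX X0; rewrite /condexp; case: xgetP => // noY; exfalso.
have mX : measurable_fun setT X by case/integrableP: iX => /measurable_EFinP.
pose Y x := fine (\int[P]_(y in cell i x) (X y)%:E) / fine (P (cell i x)).
apply: (noY Y); have YG : measurable_wrt (index_sets i) Y.
  by apply/measurable_wrt_indexP => x y xy; rewrite /Y /cell xy.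
have mY := measurable_wrt_fun YG.
have Y0 x : 0 <= Y x.
  by rewrite divr_ge0// fine_ge0// integral_ge0// => y _; rewrite lee_fin.
have XY B : index_sets i B ->
    (\int[P]_(y in B) (Y y)%:E = \int[P]_(y in B) (X y)%:E)%E.
  apply: eq_ge0_integral_index_sets => // x.
  rewrite integral_cell// cell_massE -EFinM divfK ?lt0r_neq0 ?cell_mass_gt0//.
  rewrite fineK//; apply: integrable_fin_num; first exact: measurable_cell.
  by apply: integrableS iX => //; exact: measurable_cell.
split => //; apply/integrableP; split; first exact/measurable_EFinP.
under eq_integral do rewrite /= ger0_norm//.
rewrite XY; last by exists setT => //; rewrite preimage_setT.
have /integrableP[_] := iX.
by under eq_integral do rewrite /= ger0_norm//.
Qed.

End one_measure.
End one_index.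
End index_sigma_algebra.

(** * Integrals and conditional expectations of nonnegative functions *)
Section nonnegative_integrals.
Context d (T : measurableType d) (R : realType).
Implicit Types (P : probability T R) (X Y : T -> R) (B : set T).

Lemma probability_inhabited P : exists x : T, True.
Proof.
apply: contrapT => noT; have := @probability_setT _ _ _ P.
have -> : [set: T] = set0 by apply/seteqP; split=> x _ //; apply: noT; exists x.
by rewrite measure0 => /esym/eqP; rewrite onee_eq0.
Qed.

Lemma integral_cst_probability P (r : \bar R) : (\int[P]_x cst r x = r)%E.
Proof.
rewrite (integral_cst P measurableT r) -[RHS]mule1; congr (_ * _)%E.
exact: probability_setT.
Qed.

Lemma integrable_ge0 P X : measurable_fun setT X -> (forall x, 0 <= X x) ->
  (\int[P]_x (X x)%:E < +oo)%E -> P.-integrable setT (EFin \o X).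
Proof.
move=> mX X0 iX; apply/integrableP; split; first exact/measurable_EFinP.
by under eq_integral do rewrite /= ger0_norm//.
Qed.

Lemma integral_ge0D P X Y B : measurable B ->
  measurable_fun setT X -> measurable_fun setT Y ->
  (forall x, 0 <= X x) -> (forall x, 0 <= Y x) ->
  (\int[P]_(x in B) (X x + Y x)%:E =
   \int[P]_(x in B) (X x)%:E + \int[P]_(x in B) (Y x)%:E)%E.
Proof.
move=> mB mX mY X0 Y0; under eq_integral do rewrite EFinD.
rewrite ge0_integralD//.
- by move=> x _; rewrite lee_fin.
- exact/measurable_EFinP/measurable_funTS.
- by move=> x _; rewrite lee_fin.
- exact/measurable_EFinP/measurable_funTS.
Qed.

Lemma integral_ge0Z P X B (k : R) : measurable B -> measurable_fun setT X ->
  (forall x, 0 <= X x) -> 0 <= k ->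
  (\int[P]_(x in B) (k * X x)%:E = k%:E * \int[P]_(x in B) (X x)%:E)%E.
Proof.
move=> mB mX X0 k0; under eq_integral do rewrite EFinM.
rewrite ge0_integralZl//; first exact/measurable_EFinP/measurable_funTS.
by move=> x _; rewrite lee_fin.
Qed.

Lemma integral_ge0_le P X Y B : measurable B ->
  measurable_fun setT X -> measurable_fun setT Y ->
  (forall x, 0 <= X x) -> (forall x, X x <= Y x) ->
  (\int[P]_(x in B) (X x)%:E <= \int[P]_(x in B) (Y x)%:E)%E.
Proof.
move=> mB mX mY X0 XY; apply: ge0_le_integral => //.
- by move=> x _; rewrite lee_fin.
- exact/measurable_EFinP/measurable_funTS.
- exact/measurable_EFinP/measurable_funTS.
- by move=> x _; rewrite lee_fin.
Qed.

End nonnegative_integrals.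

Section condexp_of_index.
Context d (T : measurableType d) (R : realType).
Variables (i : T -> nat) (P : probability T R).
Hypothesis mi : index_sets i `<=` measurable.
Hypothesis hP : charges_cells i P.
Implicit Types X Y : T -> R.

Lemma condexp_cell X x : P.-integrable setT (EFin \o X) ->
  (forall x, 0 <= X x) ->
  ((condexp P (index_sets i) X x)%:E * P (cell i x)
    = \int[P]_(y in cell i x) (X y)%:E)%E.
Proof.
move=> iX X0; have [mY _ XY] := condexpP mi hP iX X0.
by rewrite -integral_cell// XY//; exact: index_sets_cell.
Qed.

Lemma condexp_ge0 X x : P.-integrable setT (EFin \o X) ->
  (forall x, 0 <= X x) -> 0 <= condexp P (index_sets i) X x.
Proof.
move=> iX X0; have := condexp_cell x iX X0.
rewrite (cell_massE mi) -(pmulr_lge0 _ (cell_mass_gt0 mi hP x)) -lee_fin EFinM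
  => ->.
by apply: integral_ge0 => y _; rewrite lee_fin.
Qed.

Lemma condexp_known X : measurable_wrt (index_sets i) X ->
  P.-integrable setT (EFin \o X) -> condexp P (index_sets i) X = X.
Proof. by move=> mX iX; exact: condexp_unique. Qed.

Lemma condexp_trivial X x : (forall y, i y = i x) ->
  P.-integrable setT (EFin \o X) -> (forall x, 0 <= X x) ->
  ((condexp P (index_sets i) X x)%:E = \int[P]_y (X y)%:E)%E.
Proof.
move=> ix iX X0; have := condexp_cell x iX X0.
have -> : cell i x = setT by apply/seteqP; split => // y _; exact: ix.
by rewrite probability_setT mule1.
Qed.

Lemma integral_ge0_eq0 X : measurable_wrt (index_sets i) X ->
  (forall x, 0 <= X x) -> (\int[P]_x (X x)%:E <= 0)%E -> forall x, X x = 0.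
Proof.
move=> mX X0 iX x; apply/eqP; rewrite eq_le X0 andbT.
rewrite -(pmulr_lle0 _ (cell_mass_gt0 mi hP x)) -lee_fin EFinM -cell_massE//.
rewrite -integral_cell//; apply: le_trans iX.
apply: ge0_subset_integral => //; first exact: measurable_cell.
- exact/measurable_EFinP/(measurable_wrt_fun mi).
- by move=> y _; rewrite lee_fin.
Qed.

End condexp_of_index.

Section condexp_positive_part.
Context d (T : measurableType d) (R : realType).

(** The two functions have the same integrals, hence the same set of versions
    to choose from: the equality holds everywhere. *)
Lemma condexp_ae_ge0 (P : probability T R) G (X : T -> R) :
  {ae P, forall x, 0 <= X x} -> measurable_fun setT X -> G `<=` measurable ->
  condexp P G X = condexp P G (fun x => Num.max (X x) 0).
Proof.
move=> X0 mX Gm; rewrite /condexp; congr (xget _ _).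
have EX B : G B -> (\int[P]_(x in B) (X x)%:E =
    \int[P]_(x in B) (Num.max (X x) 0)%:E)%E.
  move=> /Gm mB; apply: ae_eq_integral => //.
  - exact/measurable_EFinP/measurable_funTS.
  - exact/measurable_EFinP/measurable_funTS/measurable_maxr.
  - by apply: filterS X0 => x x0 _; rewrite (max_idPl x0).
by apply/seteqP; split=> Y [mY iY XY]; split=> // B GB; rewrite XY// EX.
Qed.

End condexp_positive_part.

Section equal_laws_given_the_first_index.
Context d (T : measurableType d) (R : realType).
Variables (idx : nat -> T -> nat) (P P0 : probability T R).
Notation FF := (fun n => index_sets (idx n)).
Hypothesis FF_mono : forall k m, (k <= m)%N -> FF k `<=` FF m.
Hypothesis mFF : forall n, FF n `<=` measurable.
Hypothesis hP : forall n, charges_cells (idx n) P.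
Hypothesis hP0 : forall n, charges_cells (idx n) P0.
Hypothesis proportional : forall x, exists c : R, 0 <= c /\
  forall B, measurable B -> B `<=` cell (idx 1) x -> P B = (c%:E * P0 B)%E.
Implicit Types X Y : T -> R.

Lemma integral_in_first_cell x : exists c : R, forall B X,
  measurable B -> B `<=` cell (idx 1) x ->
  measurable_fun setT X -> (forall x, 0 <= X x) ->
  (\int[P]_(y in B) (X y)%:E = c%:E * \int[P0]_(y in B) (X y)%:E)%E.
Proof.
have [c [c0 PE]] := proportional x; exists c => B X mB Bx mX X0.
rewrite (eq_measure_integral (mscale (NngNum c0) P0)).
  rewrite ge0_integral_mscale//; first exact/measurable_EFinP/measurable_funTS.
  by move=> y _; rewrite lee_fin.
by move=> C mC CB; exact: (PE C mC (subset_trans CB Bx)).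
Qed.

(** Blocks of F_k with k >= 1 lie inside blocks of F_1, where P is a multiple of
    P0; the constant cancels. *)
Lemma transfer_integrals k X Y : (0 < k)%N ->
  measurable_fun setT X -> measurable_fun setT Y ->
  (forall x, 0 <= X x) -> (forall x, 0 <= Y x) ->
  (forall B, FF k B ->
    \int[P0]_(x in B) (X x)%:E = \int[P0]_(x in B) (Y x)%:E)%E ->
  forall B, FF k B -> (\int[P]_(x in B) (X x)%:E = \int[P]_(x in B) (Y x)%:E)%E.
Proof.
move=> k0 mX mY X0 Y0 XY; apply: eq_ge0_integral_index_sets => // x.
have [c cE] := integral_in_first_cell x.
have mC : measurable (cell (idx k) x) by exact: measurable_cell.
have sC : cell (idx k) x `<=` cell (idx 1) x.
  exact/(cell_sub (FF_mono k0 (index_sets_cell _ _))).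
by rewrite !cE// XY//; exact: index_sets_cell.
Qed.

(** The version for P0 satisfies the defining equations for P as well. *)
Lemma condexp_transfer k X : (0 < k)%N ->
  P.-integrable setT (EFin \o X) -> P0.-integrable setT (EFin \o X) ->
  (forall x, 0 <= X x) -> condexp P (FF k) X = condexp P0 (FF k) X.
Proof.
move=> k0 iX iX0 X0.
have mX : measurable_fun setT X by case/integrableP: iX => /measurable_EFinP.
have [mY iY XY] := condexpP (@mFF k) (hP0 k) iX0 X0.
have Y0 x : 0 <= condexp P0 (FF k) X x by exact: condexp_ge0.
have XYP : forall B, FF k B -> (\int[P]_(x in B) (condexp P0 (FF k) X x)%:E
    = \int[P]_(x in B) (X x)%:E)%E.
  by apply: transfer_integrals => //; exact: measurable_wrt_fun mY.
apply: condexp_unique => //; split => //.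
apply: integrable_ge0 => //; first exact: measurable_wrt_fun mY.
rewrite XYP; last by exists setT => //; rewrite preimage_setT.
have /integrableP[_] := iX.
by under eq_integral do rewrite /= ger0_norm//.
Qed.

End equal_laws_given_the_first_index.

(** * Processes adapted to a sequence of partitions *)
Section running_sums.
Context d (T : measurableType d) (R : realType).
Variable idx : nat -> T -> nat.
Notation FF := (fun n => index_sets (idx n)).
Hypothesis FF_mono : forall k m, (k <= m)%N -> FF k `<=` FF m.

Definition running_sum (g : nat -> T -> R) m x := \sum_(j < m.+1) g j x.

Definition compensated (f g : nat -> T -> R) m x := f m x + running_sum g m x.

Lemma running_sum0 g x : running_sum g 0 x = g 0%N x.
Proof. by rewrite /running_sum big_ord1. Qed.

Lemma running_sumS g m x :
  running_sum g m.+1 x = running_sum g m x + g m.+1 x.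
Proof. by rewrite /running_sum big_ord_recr. Qed.

Lemma running_sum_ge0 g m x :
  (forall m x, 0 <= g m x) -> 0 <= running_sum g m x.
Proof. by move=> g0; apply: sumr_ge0 => j _; exact: g0. Qed.

Lemma measurable_wrt_mono k m (X : T -> R) : (k <= m)%N ->
  measurable_wrt (FF k) X -> measurable_wrt (FF m) X.
Proof.
move=> km /measurable_wrt_indexP Xk; apply/measurable_wrt_indexP => x y xy.
apply: Xk; have := cell_sub (FF_mono km (index_sets_cell (idx k) y)) (erefl _).
by move=> /(_ x xy).
Qed.

Lemma running_sum_adapted g : adapted FF g -> adapted FF (running_sum g).
Proof.
move=> ag m; apply/measurable_wrt_indexP => x y xy.
apply: eq_bigr => j _; move: x y xy; apply/measurable_wrt_indexP.
by apply: measurable_wrt_mono (@ag j); rewrite -ltnS.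
Qed.

End running_sums.

Section set_martingales.
Context d (T : measurableType d) (R : realType).
Variable idx : nat -> T -> nat.
Notation FF := (fun n => index_sets (idx n)).
Hypothesis idx0 : forall x y, idx 0 x = idx 0 y.
Hypothesis mFF : forall n, FF n `<=` measurable.

(** Martingales in terms of integrals over sets, which are linear in the measure
    and so pass to mixtures at once. *)
Definition set_martingale (P : probability T R) (N : nat -> T -> R) :=
  forall k m B, (k <= m)%N -> index_sets (idx k) B ->
  (\int[P]_(x in B) (N m x)%:E = \int[P]_(x in B) (N k x)%:E)%E.

Variables (P : probability T R) (N : nat -> T -> R).
Hypothesis N_mart : set_martingale P N.
Hypothesis N_adapted : adapted FF N.
Hypothesis N_ge0 : forall m x, 0 <= N m x.

Lemma initial_sets B : FF 0 B -> B = set0 \/ B = setT.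
Proof.
move=> FB; have [->|/set0P[x Bx]] := eqVneq B set0; first by left.
right; apply/seteqP; split => // y _; apply: (cell_sub FB Bx).
exact: idx0.
Qed.

Lemma integral_initial (X : T -> R) x : measurable_wrt (FF 0) X ->
  (\int[P]_y (X y)%:E = (X x)%:E)%E.
Proof.
move=> /measurable_wrt_indexP X0;
  rewrite -(integral_cst_probability P (X x)%:E).
by apply: eq_integral => y _; rewrite /cst (X0 _ _ (idx0 x y)).
Qed.

Lemma mart_meas m : measurable_fun setT (N m).
Proof. exact: (measurable_wrt_fun (@mFF m) (@N_adapted m)). Qed.

Lemma mart_mean m x : (\int[P]_y (N m y)%:E = (N 0 x)%:E)%E.
Proof.
rewrite (N_mart (leq0n m)); last by exists setT.
exact: integral_initial (@N_adapted 0).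
Qed.

Lemma mart_int m : P.-integrable setT (EFin \o N m).
Proof.
apply: integrable_ge0 => //; first exact: mart_meas.
have [x _] := probability_inhabited P.
by rewrite (mart_mean _ x) ltry.
Qed.

Lemma mart_condexp k m : (forall n, charges_cells (idx n) P) -> (k <= m)%N ->
  condexp P (FF k) (N m) = N k.
Proof.
move=> hP km; apply: condexp_unique => //; split => //; first exact: mart_int.
by move=> B FB; rewrite (N_mart km).
Qed.

End set_martingales.

(** * Condition A and the equality of the conditional laws *)
Section atomic_filtration.
Context d (T : measurableType d) (R : realType).
Variables (FF : nat -> set (set T)) (A : nat -> nat -> set T).
Variables (I : nat -> nat -> set nat).
Hypothesis hFF : filtration FF.
Hypothesis hA : condition_A FF A I.

(** The trivial F_0 has a single block. *)
Definition block_index n (x : T) : nat :=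
  if n is 0%N then 0%N else xget 0%N [set s | A n s x].

Lemma block_indexE n s : (0 < n)%N -> block_index n @^-1` [set s] = A n s.
Proof.
move=> n0; have [_ /(_ _ n0)[_ Adisj Acov _ _]] := hA.
have -> : block_index n = fun x =>
  xget 0%N [set s | A n s x] by case: n n0 {Adisj Acov}.
have Auniq x t u : A n t x -> A n u x -> t = u.
  move=> At Au; have [//|/Adisj/seteqP[Atu _]] := eqVneq t u.
  by have := Atu x (conj At Au).
apply/seteqP; split => x /=; last first.
  by move=> Asx; case: xgetP => [t _ /Auniq/(_ Asx)->//|/(_ s)].
case: xgetP => [t _ At <-//|noA].
have : [set: T] x by [].
by rewrite -Acov => -[t _ /noA].
Qed.

Lemma block_index_eq n s x : (0 < n)%N -> A n s x -> block_index n x = s.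
Proof. by move=> n0; rewrite -block_indexE. Qed.

Lemma filtration_index n : FF n = index_sets (block_index n).
Proof.
have [sFF FFS FFm FF0] := hFF.
have sI := sigma_algebra_index_sets (block_index n).
have [->|n0] := posnP n.
  rewrite FF0; apply/seteqP; split => [B [->|->]|B [D _ <-]].
  - by exists set0 => //; rewrite preimage_set0.
  - by exists setT => //; rewrite preimage_setT.
  - have [D0|D0] := pselect (D 0%N).
      by right; apply/seteqP; split.
    by left; apply/seteqP; split.
have [_ /(_ _ n0)[[mA FFA] _ _ _ _]] := hA.
apply/seteqP; split.
  rewrite FFA; apply: smallest_sub => // _ [s _ <-].
  by exists [set s] => //; rewrite block_indexE.
move=> _ [D _ <-].
have [F0 _ Fcup] := sFF n.
have -> : block_index n @^-1` D =
    \bigcup_s (if s \in D then A n s else set0).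
  rewrite -bigcup_mkcond; apply/seteqP; split=> [x Dx|x [s Ds]].
    by exists (block_index n x) => //; rewrite -block_indexE.
  by rewrite -block_indexE// => /= xs; rewrite /preimage /= xs.
apply: Fcup => s; case: ifP => // _; rewrite FFA; apply: sub_sigma_algebra.
by exists s.
Qed.

Lemma block_index_cell n x : (0 < n)%N ->
  cell (block_index n) x = A n (block_index n x).
Proof. exact: block_indexE. Qed.

Lemma filtration_measurable n : index_sets (block_index n) `<=` measurable.
Proof. by rewrite -filtration_index; case: hFF. Qed.

Lemma filtration_mono k m : (k <= m)%N -> FF k `<=` FF m.
Proof.
have [_ FFS _ _] := hFF.
elim: m => [|m IHm]; first by rewrite leqn0 => /eqP ->.
rewrite leq_eqVlt ltnS => /orP[/eqP ->//|/IHm km].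
exact: subset_trans km (FFS m).
Qed.

Lemma charges_block_cells (P : probability T R) :
  (forall n s, (0 < n)%N -> (0 < P (A n s))%E) ->
  forall n, charges_cells (block_index n) P.
Proof.
move=> PA [|n] x; last by rewrite block_index_cell// PA.
have -> : cell (block_index 0) x = setT by apply/seteqP; split.
by rewrite probability_setT lte01.
Qed.

Section equal_conditional_laws.
Variables P P0 : probability T R.
Hypothesis PA : forall n s, (0 < n)%N -> (0 < P (A n s))%E.
Hypothesis P0A : forall n s, (0 < n)%N -> (0 < P0 (A n s))%E.
Hypothesis ratio : forall n s j, (0 < n)%N -> I n s j ->
  fine (P (A n.+1 j)) / fine (P (A n s))
    <= fine (P0 (A n.+1 j)) / fine (P0 (A n s)).

Let mA n s : (0 < n)%N -> measurable (A n s).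
Proof. by move=> n0; have [_ /(_ _ n0)[[]]] := hA. Qed.

Let massE (Q : probability T R) B : measurable B -> Q B = (fine (Q B))%:E.
Proof. by move=> mB; rewrite fineK// fin_num_measure. Qed.

Let c n s : R := fine (P (A n s)) / fine (P0 (A n s)).

Let c_ge0 n s : 0 <= c n s.
Proof. by rewrite divr_ge0// fine_ge0. Qed.

Let mass_gt0 n s : (0 < n)%N -> 0 < fine (P (A n s)).
Proof. by move=> n0; rewrite -lte_fin -massE ?PA//; exact: mA. Qed.

Let mass0_gt0 n s : (0 < n)%N -> 0 < fine (P0 (A n s)).
Proof. by move=> n0; rewrite -lte_fin -massE ?P0A//; exact: mA. Qed.

Let measure_slices (Q : probability T R) n B : FF n B ->
  Q B = (\sum_(0 <= j <oo) Q (B `&` block_index n @^-1` [set j]))%E.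
Proof.
rewrite filtration_index => /(index_sets_decomp (@filtration_measurable n)).
move=> [mB tB {1}->].
by rewrite measure_semi_bigcup//; exact: bigcup_measurable.
Qed.

(** Sum of the assumed inequalities over the blocks of F_(n+1) inside B. *)
Lemma one_step_law_le n s B : (0 < n)%N -> FF n.+1 B -> B `<=` A n s ->
  (P B <= (c n s)%:E * P0 B)%E.
Proof.
move=> n0 FB BA; have := FB; rewrite filtration_index => IB.
rewrite (measure_slices P FB) (measure_slices P0 FB).
rewrite -nneseriesZl; last by [].
apply: lee_nneseries => [//|j _].
have [->|[x Bx ->]] := index_set_slice j IB; first by rewrite !measure0 mule0.
rewrite block_index_cell//; set t := block_index n.+1 x.
have Ist : I n s t.
  have [_ /(_ _ n0)[_ _ _ AI _]] := hA.
  have := BA _ Bx; rewrite AI => -[u Iu].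
  by rewrite /t => /block_index_eq ->.
rewrite (massE P); last exact: mA.
rewrite (massE P0); last exact: mA.
rewrite -EFinM lee_fin /c mulrAC -mulrA -ler_pdivrMl ?mass_gt0// mulrC.
exact: ratio.
Qed.

(** The inequality for the complement of B in A n s is the reverse inequality,
    because the two masses of A n s correspond. *)
Lemma one_step_law n s B : (0 < n)%N -> FF n.+1 B -> B `<=` A n s ->
  P B = ((c n s)%:E * P0 B)%E.
Proof.
move=> n0 FB BA; apply/eqP; rewrite eq_le one_step_law_le//=.
have [sFF _ FFm _] := hFF.
have FA : FF n.+1 (A n s).
  apply: (filtration_mono (leqnSn n)); rewrite filtration_index.
  by exists [set s] => //; rewrite block_indexE.
have FC : FF n.+1 (A n s `\` B).
  have := FB; have := FA; rewrite filtration_index => -[D1 _ <-] [D2 _ <-].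
  by exists (D1 `\` D2).
have mB := FFm _ _ FB; have mAs := FFm _ _ FA; have mC := FFm _ _ FC.
have PD (Q : probability T R) : Q (A n s `\` B) = (Q (A n s) - Q B)%E.
  by rewrite measureD ?(setIidr BA)// ltey_eq fin_num_measure.
have := one_step_law_le n0 FC (@subDsetl _ _ _); rewrite !PD.
rewrite (massE P mB) (massE P mAs) (massE P0 mB) (massE P0 mAs).
rewrite -!EFinB -!EFinM !lee_fin mulrBr /c divfK ?lt0r_neq0 ?mass0_gt0//.
by rewrite lerD2l lerN2.
Qed.

(** Chain rule: the ratio of P to P0 on a block is inherited by all later blocks
    inside it. *)
Lemma law_on_first_cell n t B : (0 < n)%N -> FF n B -> B `<=` A 1 t ->
  P B = ((c 1 t)%:E * P0 B)%E.
Proof.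
elim: n B => // -[_|n IHn] B _ FB BA.
  have [->|/set0P[x Bx]] := eqVneq B set0; first by rewrite !measure0 mule0.
  have -> : B = A 1 t.
    apply/seteqP; split => //; move: FB; rewrite filtration_index => /cell_sub.
    move=> /(_ _ Bx); rewrite block_index_cell//.
    by rewrite (block_index_eq _ (BA _ Bx)).
  rewrite (massE P); last exact: mA.
rewrite (massE P0); last exact: mA.
  by rewrite -EFinM /c divfK// lt0r_neq0// mass0_gt0.
have FBs s : FF n.+2 (B `&` A n.+1 s).
  move: FB; have : FF n.+2 (A n.+1 s).
    apply: (filtration_mono (leqnSn n.+1)); rewrite filtration_index.
    by exists [set s] => //; rewrite block_indexE.
  by rewrite filtration_index => ? ?; exact: index_setsI.
have [_ _ FFm _] := hFF.
have slices (Q : probability T R) :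
    Q B = (\sum_(0 <= j <oo) Q (B `&` A n.+1 j))%E.
  have {1}-> : B = \bigcup_s (B `&` A n.+1 s).
    apply/seteqP; split=> [x Bx|x [s _ []//]]; exists (block_index n.+1 x) =>
      //.
    by split => //; rewrite -block_indexE.
  rewrite measure_semi_bigcup//.
  - by move=> s; exact: FFm (FBs s).
  - apply/trivIsetP => s u _ _ su; apply/seteqP; split=> // x [[_]].
    move=> /block_index_eq xs [_ /block_index_eq xu].
    by move: su; rewrite -xs// xu// eqxx.
  - by apply: bigcup_measurable => s _; exact: FFm (FBs s).
rewrite !slices -nneseriesZl; last by [].
apply: eq_eseriesr => s _.
have [->|/set0P[x [Bx Ax]]] := eqVneq (B `&` A n.+1 s) set0.
  by rewrite !measure0 mule0.
rewrite (one_step_law _ (FBs s) (@subIsetr _ _ _))//.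
have AA1 : A n.+1 s `<=` A 1 t.
  have : FF n.+1 (A 1 t).
    apply: (@filtration_mono 1) => //; rewrite filtration_index.
    by exists [set t] => //; rewrite block_indexE.
  rewrite filtration_index => FA1; have := cell_sub FA1 (BA _ Bx).
  by rewrite block_index_cell// (block_index_eq _ Ax).
have FA : FF n.+1 (A n.+1 s).
  by rewrite filtration_index; exists [set s] => //; rewrite block_indexE.
have := IHn _ isT FA AA1.
rewrite (massE P); last exact: mA.
rewrite (massE P0); last exact: mA.
by rewrite -EFinM => -[PAE]; rewrite /c PAE mulfK// lt0r_neq0// mass0_gt0.
Qed.

(** The union of the F_n is stable under intersection and generates all
    measurable sets, so measures that agree on it are equal. *)
Lemma proportional_on_first_cell x B : measurable B ->
  B `<=` cell (block_index 1) x ->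
  P B = ((fine (P (A 1 (block_index 1 x))) /
          fine (P0 (A 1 (block_index 1 x))))%:E * P0 B)%E.
Proof.
set t := block_index 1 x; rewrite block_index_cell// -/t => mB BA.
have mAt : measurable (A 1 t) by exact: mA.
have [_ _ FFm _] := hFF; have [mFF _] := hA.
suff: mrestr P mAt B = mscale (NngNum (c_ge0 1 t)) (mrestr P0 mAt) B.
  by rewrite /mscale/= /mrestr (setIidl BA).
apply: (@measure_unique _ _ _ (\bigcup_n FF n) (fun=> setT)) => //.
- move=> B1 B2 [n _ F1] [m _ F2]; exists (maxn n m) => //.
  have := filtration_mono (leq_maxl n m) F1.
  have := filtration_mono (leq_maxr n m) F2.
  by rewrite filtration_index => ? ?; exact: index_setsI.
- by move=> _; exists 0%N => //; have [_ _ _ ->] := hFF; right.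
- by rewrite bigcup_const.
- move=> C [n _ FC]; rewrite /mscale/= /mrestr.
  apply: (@law_on_first_cell n.+1) => //.
  have : FF n.+1 (A 1 t).
    apply: (@filtration_mono 1) => //; rewrite filtration_index.
    by exists [set t] => //; rewrite block_indexE.
  have := filtration_mono (leqnSn n) FC.
  by rewrite filtration_index => ? ?; exact: index_setsI.
- by move=> _; rewrite /mrestr ltey_eq fin_num_measure// setTI.
Qed.

End equal_conditional_laws.
End atomic_filtration.

(** * Maximal chains and finite families of measures *)

(** Zorn's lemma for the sets that remain chains once g is added. *)
Lemma maximal_chain_through (U : Type) (le : U -> U -> Prop) (S : set U) g :
  S g -> le g g -> exists2 C : set U, C g &
    [/\ C `<=` S, total_on C le &
        forall D, D `<=` S -> total_on D le -> C `<=` D -> D = C].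
Proof.
move=> Sg gg.
pose good := [set C : set U | C `|` [set g] `<=` S /\
                              total_on (C `|` [set g]) le].
have [F Fgood Ftot|C [[CS Ctot] Cmax]] := @Zorn_bigcup U good.
  split=> [x [[C FC Cx]|->//]|x y]; first by apply: (Fgood _ FC).1; left.
  have tot2 C D a b : F C -> F D -> C a -> D b -> le a b \/ le b a.
    move=> FC FD Ca Db; have [CD|DC] := Ftot _ _ FC FD.
      by apply: (Fgood _ FD).2; left => //; exact: CD.
    by apply: (Fgood _ FC).2; left => //; exact: DC.
  move=> [[C FC Cx]|->] [[D FD Dy]|->].
  - exact: tot2 Cx Dy.
  - by apply: (Fgood _ FC).2; [left|right].
  - by apply: (Fgood _ FD).2; [right|left].
  - by left.
have Cg : C g.
  apply: contrapT => nCg; apply: (Cmax (C `|` [set g])).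
    by split=> [x Cx|CgC]; [left|apply: nCg; apply: CgC; right].
  by rewrite /good /= -setUA setUid; split.
have CgE : C `|` [set g] = C by apply/seteqP; split=> [x [//|->//]|x]; left.
exists C => //; split; [by rewrite -CgE|by rewrite -CgE|].
move=> D DS Dtot CD; apply: contrapT => DC; apply: (Cmax D).
  by split=> // DC'; apply: DC; apply/seteqP; split.
rewrite /good /=; have -> : D `|` [set g] = D.
  by apply/seteqP; split=> [x [//|->]|x]; [exact: CD|left].
by split.
Qed.

Section finite_families.
Context d (T : measurableType d) (R : realType).

Lemma density_bounded_single (P : probability T R) :
  density_bounded (fun _ : 'I_1 => P).
Proof.
exists 1, 1; split=> // i j.
have PP : P `<< P by [].
suff : ae_eq P setT (Radon_Nikodym (charge_of_finite_measure P) P) (cst 1%E).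
  by apply: filterS => x /(_ Logic.I) ->; rewrite !lexx.
apply: integral_ae_eq => //; first exact: Radon_Nikodym_integrable.
move=> B _ mB; rewrite -Radon_Nikodym_integral// integral_cst//.
by rewrite mul1e.
Qed.

Lemma mixture_component s (Ph : 'I_s -> probability T R) i : mixtures Ph (Ph i).
Proof.
exists (fun j => (j == i)%:R); split=> [j||B mB].
- exact: ler0n.
- by rewrite (bigD1 i)//= eqxx big1 ?addr0// => j /negbTE ->.
- rewrite (bigD1 i)//= eqxx big1 ?adde0 ?mul1e// => j /negbTE ->.
  by rewrite mul0e.
Qed.

Lemma integral_mixture s (Ph : 'I_s.+1 -> probability T R) (Q : probability T R)
    (gam : 'I_s.+1 -> R) (X : T -> R) B :
  (forall i, 0 <= gam i) ->
  (forall B, measurable B -> Q B = (\sum_(i < s.+1) (gam i)%:E * Ph i B)%E) ->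
  measurable B -> measurable_fun setT X -> (forall x, 0 <= X x) ->
  (\int[Q]_(x in B) (X x)%:E =
    \sum_(i < s.+1) (gam i)%:E * \int[Ph i]_(x in B) (X x)%:E)%E.
Proof.
move=> gam0 QE mB mX X0.
have mXB : measurable_fun B (EFin \o X) by
  exact/measurable_EFinP/measurable_funTS.
have X0B x : B x -> (0 <= (EFin \o X) x)%E by rewrite lee_fin.
pose m n : {measure set T -> \bar R} :=
  mscale (NngNum (gam0 (inord n))) (Ph (inord n)).
rewrite (eq_measure_integral (msum m s.+1)).
  rewrite ge0_integral_measure_sum//; apply: eq_bigr => i _.
  by rewrite ge0_integral_mscale//= inord_val.
move=> C mC _; apply: (etrans (QE C mC)); apply: eq_bigr => i _.
by rewrite /m /mscale /= inord_val.
Qed.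

End finite_families.

(** * A density for the limit of uniformly integrable functions *)
Section uniform_integrability.
Context d (T : measurableType d) (R : realType).

Lemma ultra_bounded_cvg (U : set_system nat) (a : nat -> R) (b c : R) :
  UltraFilter U -> (forall n, b <= a n <= c) -> cvg (a n @[n --> U]).
Proof.
move=> UU abc.
have Uabc : (a n @[n --> U]) `[b, c]%classic.
  suff : U (a @^-1` `[b, c]%classic) by [].
  by apply: filterE => n; rewrite /preimage /= in_itv/=; exact: abc.
have [p [_ cp]] := @segment_compact _ b c (a n @[n --> U]) _ Uabc;
  apply/cvg_ex; exists p => V nV.
have [//|UV] := in_ultra_setVsetC (a @^-1` V) UU.
by have [x []] := cp (~` V) V UV nV.
Qed.

Variable P : probability T R.

Lemma additive_tail (lam : set T -> R) (F : nat -> set T) n :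
  (forall B C, measurable B -> measurable C -> B `&` C = set0 ->
    lam (B `|` C) = lam B + lam C) ->
  (forall i, measurable (F i)) -> trivIset setT F ->
  lam (\bigcup_(i in [set i | (n <= i)%N]) F i) + \sum_(0 <= i < n) lam (F i)
    = lam (\bigcup_i F i).
Proof.
move=> lamU mF tF; elim: n => [|n IHn].
  by rewrite big_geq// addr0; congr lam; apply: eq_bigcupl; split.
rewrite -IHn big_nat_recr//= addrCA addrC; congr (_ + _).
have -> : \bigcup_(i in [set i | (n <= i)%N]) F i =
    F n `|` \bigcup_(i in [set i | (n < i)%N]) F i.
  apply/seteqP; split=> [x [i /= ni Fi]|x [Fn|[i /= ni Fi]]].
  - by move: ni; rewrite leq_eqVlt => /orP[/eqP ->|ni]; [left|right; exists i].
  - by exists n => /=.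
  - by exists i => //=; exact: ltnW.
rewrite lamU 1?addrC//; first exact: bigcup_measurable.
apply/seteqP; split => // x [Fn [i /= ni Fi]].
by have := tF n i I I; move: ni => /[swap] ->; [rewrite ltnn|exists x].
Qed.

Variable f : nat -> T -> R.
Hypothesis mf : forall n, measurable_fun setT (f n).
Hypothesis f_ge0 : forall n x, 0 <= f n x.
Hypothesis fui : uniformly_integrable P f.

(** On B, split f_n at a level c above which its integral is at most e / 2
    uniformly in n; below the level it contributes at most c times P(B). *)
Lemma uniform_absolute_continuity (e : R) : 0 < e -> exists2 del : R, 0 < del &
  forall B, measurable B -> (P B < del%:E)%E ->
  forall n, (\int[P]_(x in B) (f n x)%:E <= e%:E)%E.
Proof.
move=> e0; have e20 : 0 < e / 2 by rewrite divr_gt0.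
have [c /= [c0 tailc]] : exists c, 0 < c /\ forall n,
    (\int[P]_(x in [set x | (c < `|f n x|)%R]) (`|f n x|%R)%:E <= (e / 2)%:E)%E.
  have /fui : nbhs 0%E [set y : \bar R | (y < (e / 2)%:E)%E].
    exact: (@nbhs_open_ereal_lt R 0 (fun=> e / 2)).
  move=> [A [_ Ac]]; pose c := Num.max A 0 + 1.
  have cA : A < c by rewrite /c ltr_pwDr// le_max lexx.
  exists c; split; first by rewrite /c ltr_pwDr// le_max lexx orbT.
  move=> n; apply/ltW/(le_lt_trans _ (Ac _ cA)).
  by apply: ereal_sup_ubound; exists n.
exists (e / (2 * c)); first by rewrite divr_gt0// mulr_gt0.
move=> B mB PB n; pose S := [set x | (c < `|f n x|)%R].
have mS : measurable S.
  rewrite (_ : S = f n @^-1` `]c, +oo[%classic); last first.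
    by apply/seteqP; split=> x; rewrite /S /= in_itv/= andbT ger0_norm.
  by rewrite -[X in measurable X]setTI; exact: mf.
have mfE D : measurable_fun D (fun x => (f n x)%:E).
  exact/measurable_EFinP/measurable_funTS.
rewrite -(setUIDK B S) ge0_integral_setU//; last 4 first.
- exact: measurableI.
- exact: measurableD.
- by move=> x _; rewrite lee_fin.
- apply/disj_setPS => x [[_ Sx] [_]]; exact.
rewrite [e in leRHS]splitr EFinD; apply: leeD.
  apply: le_trans (tailc n).
  under [leRHS]eq_integral do rewrite ger0_norm//.
  apply: ge0_subset_integral => //; first exact: measurableI.
  by move=> x _; rewrite lee_fin.
apply: (@le_trans _ _ (\int[P]_(x in B `\` S) (cst c%:E x))%E).
  apply: ge0_le_integral => //.
  - exact: measurableD.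
  - by move=> x _; rewrite lee_fin.
  - by move=> x [_ /negP]; rewrite lee_fin -leNgt ger0_norm.
rewrite integral_cst; last exact: measurableD.
apply: (@le_trans _ _ (c%:E * P B)%E).
  rewrite lee_pmul2l// ?lte_fin//; apply: le_measure; rewrite ?inE//.
  exact: measurableD.
apply: (@le_trans _ _ (c%:E * (e / (2 * c))%:E)%E).
  by rewrite lee_pmul2l// ?lte_fin// ltW.
by rewrite -EFinM lee_fin invfM [_^-1 * c^-1]mulrC mulrCA mulVKf// lt0r_neq0.
Qed.

Variable c : R.
Hypothesis f_mean : forall n, (\int[P]_x (f n x)%:E <= c%:E)%E.
Variable U : set_system nat.
Hypothesis UU : UltraFilter U.

Definition mass n B : R := fine (\int[P]_(x in B) (f n x)%:E)%E.

Let massE n B : measurable B ->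
  (\int[P]_(x in B) (f n x)%:E = (mass n B)%:E)%E.
Proof.
move=> mB; rewrite /mass fineK// ge0_fin_numE; last first.
  by apply: integral_ge0 => x _; rewrite lee_fin.
apply: le_lt_trans (ltry c); apply: le_trans (f_mean n).
apply: ge0_subset_integral => //; first exact/measurable_EFinP.
by move=> x _; rewrite lee_fin.
Qed.

Let mass_bound n B : measurable B -> 0 <= mass n B <= c.
Proof.
move=> mB; rewrite -!lee_fin -massE// integral_ge0/=; last first.
  by move=> x _; rewrite lee_fin.
apply: le_trans (f_mean n).
apply: ge0_subset_integral => //; first exact/measurable_EFinP.
by move=> x _; rewrite lee_fin.
Qed.

Let massU n B C : measurable B -> measurable C -> B `&` C = set0 ->
  mass n (B `|` C) = mass n B + mass n C.
Proof.
move=> mB mC BC; apply: EFin_inj; rewrite EFinD -!massE//;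
  last exact: measurableU.
rewrite ge0_integral_setU//.
- exact/measurable_EFinP/measurable_funTS.
- by move=> x _; rewrite lee_fin.
- by apply/disj_setPS; rewrite BC.
Qed.

(** The absolute value only matters for nonmeasurable B, where the limit along
    the ultrafilter might not exist: a measure has to be nonnegative on every
    set. *)
Definition limit_mass B : \bar R := (`|lim (mass n B @[n --> U])|)%:E.

Let lam B : R := `|lim (mass n B @[n --> U])|.

Let mass_cvg B : measurable B -> mass n B @[n --> U] --> lam B.
Proof.
move=> mB; have Bc : cvg (mass n B @[n --> U]).
  by apply: (@ultra_bounded_cvg _ _ 0 c) => // n; exact: mass_bound.
rewrite /lam ger0_norm//; apply: limr_ge => //.
by apply: filterE => n; have /andP[] := mass_bound n mB.
Qed.

Let lamU B C : measurable B -> measurable C -> B `&` C = set0 ->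
  lam (B `|` C) = lam B + lam C.
Proof.
move=> mB mC BC; apply: (@cvg_unique _ _ (mass n (B `|` C) @[n --> U])).
- exact: Rhausdorff.
- exact/mass_cvg/measurableU.
- rewrite /mkset (_ : (fun n => _) = (fun n => mass n B + mass n C)).
    by apply: cvgD; exact: mass_cvg.
  by apply/funext => n; exact: massU.
Qed.

Let lam_le B e : measurable B -> (forall n, mass n B <= e) -> lam B <= e.
Proof.
move=> mB Be; rewrite -(cvg_lim _ (mass_cvg mB))//; apply: limr_le.
  by apply/cvg_ex; exists (lam B); exact: mass_cvg.
exact: filterE.
Qed.

Let limit_mass0 : limit_mass set0 = 0%E.
Proof.
congr EFin; have := lamU measurable0 measurable0 (setI0 _).
by rewrite setU0 -{1}[lam set0]addr0 => /addrI/esym.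
Qed.

Let limit_mass_ge0 B : (0 <= limit_mass B)%E.
Proof. by rewrite lee_fin. Qed.

(** Additivity on finite families passes to the limit; the tails of a countable
    union have small probability, hence uniformly small integrals. *)
Let limit_mass_sigma_additive : semi_sigma_additive limit_mass.
Proof.
move=> F mF tF mUF.
rewrite [X in X @ \oo -->
  _](_ : _ = EFin \o (fun n => \sum_(0 <= i < n) lam (F i))); last first.
  by apply/funext => n /=; rewrite sumEFin.
suff lam_cvg : \sum_(0 <= i < n) lam (F i) @[n --> \oo] --> lam (\bigcup_i F i).
  by apply: cvg_EFin => //; exact: nearW.
apply/cvgrPdist_le => e e0.
have [del del0 abscont] := uniform_absolute_continuity e0.
pose tail n := \bigcup_(i in [set i | (n <= i)%N]) F i.
have mtail n : measurable (tail n) by exact: bigcup_measurable.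
have massP B : measurable B -> P B = (fine (P B))%:E.
  by move=> mB; rewrite fineK// fin_num_measure.
have PU B C : measurable B -> measurable C -> B `&` C = set0 ->
    fine (P (B `|` C)) = fine (P B) + fine (P C).
  move=> mB mC BC; rewrite measureU// fineD//; exact: fin_num_measure.
have : EFin (\sum_(0 <= i < n) fine (P (F i))) @[n --> \oo] -->
    (fine (P (\bigcup_i F i)))%:E.
  rewrite -massP// (_ : (fun n => _) = fun n => (\sum_(0 <= i < n) P (F i))%E).
    exact: measure_semi_sigma_additive.
  by apply/funext => n; rewrite -sumEFin; apply: eq_bigr => i _; rewrite massP.
move=> /fine_cvg/cvgrPdist_lt/(_ _ del0).
apply: filterS => n.
have -> := esym (additive_tail n PU mF tF); have -> :=
  esym (additive_tail n lamU mF tF).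
rewrite !addrK => Pt; rewrite ger0_norm; last exact: normr_ge0.
apply: (lam_le (mtail n)) => m; rewrite -lee_fin -massE; last exact: mtail.
apply: abscont; first exact: mtail.
rewrite massP; last exact: mtail.
rewrite lte_fin; apply: le_lt_trans Pt; exact: ler_norm.
Qed.

HB.instance Definition _ := isMeasure.Build d T R limit_mass
  limit_mass0 limit_mass_ge0 limit_mass_sigma_additive.

Let limit_mass_finite : fin_num_fun limit_mass.
Proof. by []. Qed.

HB.instance Definition _ := Measure_isFinite.Build d T R limit_mass
  limit_mass_finite.

(** Weak compactness in L1 of a uniformly integrable sequence: the limiting set
    function is a measure dominated by P, and the Radon-Nikodym theorem gives it
    a density. *)
Lemma limit_density : exists r : T -> \bar R,
  [/\ forall x, (0 <= r x)%E, P.-integrable setT r &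
  forall B, measurable B ->
    fine (\int[P]_(x in B) (f n x)%:E)%E @[n --> U]
      --> fine (\int[P]_(x in B) r x)%E].
Proof.
have [|r [r0 ir rE]] := @radon_nikodym_finite _ _ _ P limit_mass.
  apply/null_content_dominatesP => B mB PB0; congr EFin; apply/eqP.
  rewrite eq_le normr_ge0 andbT; apply: lam_le => // n.
  rewrite -lee_fin -massE// null_set_integral//.
  exact/measurable_EFinP/measurable_funTS.
exists r; split => // B mB; rewrite -rE//.
exact: mass_cvg.
Qed.

End uniform_integrability.

(** * The condition on the first step *)
Section stable_model.
Context d (T : measurableType d) (R : realType).
Variables (idx : nat -> T -> nat).
Notation FF := (fun n => index_sets (idx n)).
Variables (M : set (probability T R)) (P0 : probability T R).
Hypothesis idx0 : forall x y, idx 0 x = idx 0 y.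
Hypothesis FF_mono : forall k m, (k <= m)%N -> FF k `<=` FF m.
Hypothesis mFF : forall n, FF n `<=` measurable.
Hypothesis M_charges : forall P, M P -> forall n, charges_cells (idx n) P.
Hypothesis hP0 : M P0.
Hypothesis proportional : forall P, M P -> forall x, exists c : R, 0 <= c /\
  forall B, measurable B -> B `<=` cell (idx 1) x -> P B = (c%:E * P0 B)%E.
Lemma stopped_adapted k (X : nat -> T -> R) :
  adapted FF X -> adapted FF (stopped X k).
Proof.
by move=> aX m; apply: (measurable_wrt_mono FF_mono (geq_minl m k)); exact: aX.
Qed.

Lemma stopped_mart k (P : probability T R) (X : nat -> T -> R) :
  set_martingale idx P X -> set_martingale idx P (stopped X k).
Proof.
move=> mX j m B jm FB; rewrite /stopped.
have [jk|kj] := leqP j k;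
  last by rewrite (minn_idPr _)// (ltnW (leq_trans kj jm)).
by apply: mX => //; rewrite leq_min jm.
Qed.

Section process.
Variable f : nat -> T -> R.
Hypothesis f_adapted : adapted FF f.
Hypothesis f_ge0 : forall m x, 0 <= f m x.
Hypothesis f_int : forall P m, M P -> P.-integrable setT (EFin \o f m).
Hypothesis f_super : forall P k m x, M P -> (k <= m)%N ->
  condexp P (FF k) (f m) x <= f k x.

Let f_meas m : measurable_fun setT (f m).
Proof. exact: (measurable_wrt_fun (@mFF m) (@f_adapted m)). Qed.

Let FFsetT m : FF m setT.
Proof. by exists setT => //; rewrite preimage_setT. Qed.

(** The condition that both local regularity and membership in K amount to. *)
Definition first_compensator (g : T -> R) :=
  [/\ measurable_wrt (FF 1) g, forall x, 0 <= g x &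
      forall P x, M P ->
        (\int[P]_y (f 1 y)%:E + \int[P]_y (g y)%:E = (f 0 x)%:E)%E].

(** For the family that consists of P alone, the compensator g of the stopped
    process satisfies at the first step that f_1 + g_1 has mean f_0 under P and
    that g_1 and gbar_1 have the same mean, where gbar serves all P at once. *)
Lemma first_compensator_of_local_regular :
  local_regular FF M f -> exists g, first_compensator g.
Proof.
move=> [_ _ [k [kincr _ kreg]]].
have k1 : (0 < k 1)%N.
  apply: (leq_ltn_trans (leq0n (k 0))).
  by rewrite ltnNge -leEnat kincr.
have [_ _ [gbar [agbar gbar0 _ gbarint fam]]] := kreg 1%N.
have gbar1_ge0 x : 0 <= gbar 1 x.
  apply: (ae_everywhere (@mFF 1) (M_charges hP0 1) _ (gbar0 1 P0 hP0)) =>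
    y z yz.
  by have /measurable_wrt_indexP/(_ y z yz)-> := @agbar 1.
have mgbar : measurable_fun setT (gbar 1).
  exact: (measurable_wrt_fun (@mFF 1) (@agbar 1)).
exists (gbar 1); split => // P x MP.
have [_ [C [g [[Csub _ _] [Cg _] gmart ginc]]]] :=
  fam 0%N (fun _ => P) (fun _ => MP) (density_bounded_single P).
have [ag g0 gmono [_ gint _]] := Csub _ Cg.
have ag' m y z : idx m y = idx m z -> g m y = g m z.
  by move: y z; apply/measurable_wrt_indexP; exact: ag.
have g00 y : g 0%N y = 0.
  by apply: (ae_everywhere (@mFF 0) (M_charges MP 0) _ (g0 P MP)) =>
    a b /ag' ->.
have g1_ge0 y : 0 <= g 1%N y.
  rewrite -(g00 y); apply:
    (ae_everywhere (@mFF 1) (M_charges MP 1) _ (gmono 0%N P MP)).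
  move=> a b ab; rewrite (ag' _ _ _ ab) (ag' 0%N a b)//; exact: idx0.
have mg : measurable_fun setT (g 1%N).
  exact: (measurable_wrt_fun (@mFF 1) (@ag 1)).
have stop1 y : stopped f (k 1%N) 1 y = f 1 y by rewrite /stopped (minn_idPl k1).
have stop0 y : stopped f (k 1%N) 0 y = f 0 y by rewrite /stopped min0n.
have known0 (X : T -> R) : P.-integrable setT (EFin \o X) ->
  (forall x, 0 <= X x) ->
    forall y z, idx 0 y = idx 0 z ->
      condexp P (FF 0) X y = condexp P (FF 0) X z.
  move=> iX X0; apply/measurable_wrt_indexP.
  by have [] := condexpP (@mFF 0) (M_charges MP 0) iX X0.
pose X y := stopped f (k 1%N) 1 y + g 1%N y.
have X0 y : 0 <= X y by rewrite addr_ge0// stop1.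
have XE : X = f 1 \+ g 1%N by apply/funext => y; rewrite /X stop1.
have mX : measurable_fun setT X by rewrite XE; exact: measurable_funD.
have iX : P.-integrable setT (EFin \o X).
  apply: integrable_ge0 => //.
  have := gint P 1%N (mixture_component (fun _ : 'I_1 => P) ord0) isT.
  rewrite (_ : (fun y => _) = X); first by rewrite unlock.
  by apply/funext => y; exact: (ger0_norm (X0 y)).
have iG : P.-integrable setT (EFin \o gbar 1).
  by apply: integrable_ge0 => //; have := gbarint P 1%N MP isT; rewrite unlock.
have ig : P.-integrable setT (EFin \o g 1%N).
  apply: integrable_ge0 => //; apply: (@le_lt_trans _ _ (\int[P]_y (X y)%:E)%E).
    by apply: integral_ge0_le => // y; rewrite XE /= lerDr.
  have /integrableP[_] := iX.
  by under eq_integral do rewrite /= ger0_norm//.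
have triv Y y := @condexp_trivial _ _ _ _ _ (@mFF 0) (M_charges MP 0) Y y
  (fun z => idx0 z y).
have EX : condexp P (FF 0) X x = f 0 x.
  have fae : {ae P, forall y, condexp P (FF 0) X y = f 0 y}.
    by apply: filterS (gmart ord0 0%N 1%N isT isT) => y;
      rewrite stop0 g00 addr0.
  apply: (ae_everywhere (@mFF 0) (M_charges MP 0) _ fae) => y z yz.
  have /measurable_wrt_indexP/(_ y z yz)-> := @f_adapted 0.
  by rewrite (known0 _ iX X0 _ _ yz).
have Eg : condexp P (FF 0) (g 1%N) x = condexp P (FF 0) (gbar 1) x.
  have gE : (fun y => g 1%N y - g 0%N y) = g 1%N.
    by apply/funext => y; rewrite g00 subr0.
  have gae : {ae P, forall y,
      condexp P (FF 0) (fun y => g 1%N y - g 0%N y) y = condexp P (FF 0)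
        (gbar 1) y}.
    exact: (ginc ord0 1%N isT).
  rewrite gE in gae; apply: (ae_everywhere (@mFF 0) (M_charges MP 0) _ gae) =>
    y z yz.
  by rewrite (known0 _ ig g1_ge0 _ _ yz) (known0 _ iG gbar1_ge0 _ _ yz).
rewrite -(triv _ x iG gbar1_ge0) -Eg (triv _ x ig g1_ge0) -integral_ge0D//.
rewrite -EX (triv _ x iX X0); apply: eq_integral => y _.
by rewrite /X stop1.
Qed.

(** The E{xi_i | F_0} are equal to 1 and the E{xi_i | F_1} have mean 1 under
    each P, so f_0 and the mean of the sum of the C_i f^i_0 E{xi_i | F_1}
    are both equal to the sum of the C_i f^i_0. *)
Lemma first_compensator_of_K : K_ FF M f -> exists g, first_compensator g.
Proof.
move=> [_ [n [C [h [_ C0 hV fE]]]]].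
have [x0 _] := probability_inhabited P0.
have step i : exists (a : R) (e : T -> R),
    [/\ measurable_wrt (FF 1) e, forall x, 0 <= e x,
        forall x, h i 0%N x = a, forall x, h i 1%N x <= a * e x &
        forall P, M P -> (\int[P]_x (e x)%:E = 1)%E].
  have [xi [mxi xi0 xi1] [ah [u [au umono] [uint uh]]]] := hV i.
  pose X x := Num.max (xi x) 0.
  have mX : measurable_fun setT X by exact: measurable_maxr.
  have X0 x : 0 <= X x by rewrite le_max lexx orbT.
  have X1 P : M P -> (\int[P]_x (X x)%:E = 1)%E.
    move=> MP; rewrite -(xi1 P MP) unlock; apply: ae_eq_integral => //.
    - exact/measurable_EFinP.
    - exact/measurable_EFinP.
    - by apply: filterS (xi0 P MP) => x xi0x _; rewrite /X (max_idPl xi0x).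
  have iX P : M P -> P.-integrable setT (EFin \o X).
    by move=> MP; apply: integrable_ge0 => //; rewrite X1// ltry.
  pose e k := condexp P0 (FF k) X.
  have eE k : condexp P0 (FF k) xi = e k.
    by apply: condexp_ae_ge0 => //; exact: xi0.
  have e_is k : is_condexp P0 (FF k) X (e k).
    by apply: condexpP => //; [exact: M_charges|exact: iX].
  have e0 k x : 0 <= e k x by apply: condexp_ge0;
    [exact: mFF|exact: M_charges|exact: iX|].
  have huE k x : h i k x = u k x * e k x.
    apply: (ae_everywhere (@mFF k) (M_charges hP0 k)
      (S := fun x => h i k x = u k x * e k x)).
      move=> y z yz; have /measurable_wrt_indexP/(_ y z yz)-> := @ah k.
      have /measurable_wrt_indexP/(_ y z yz)-> := @au k.
      by have [/measurable_wrt_indexP/(_ y z yz)-> _ _] := e_is k.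
    by have := uh P0 k hP0; rewrite eE.
  have u10 x : u 1%N x <= u 0%N x.
    apply: (ae_everywhere (@mFF 1) (M_charges hP0 1) _ (umono 0%N P0 hP0)) =>
      y z yz.
    have /measurable_wrt_indexP/(_ y z yz)-> := @au 1%N.
    by have /measurable_wrt_indexP/(_ y z (idx0 y z))-> := @au 0%N.
  have u0 x : u 0%N x = u 0%N x0.
    by have /measurable_wrt_indexP/(_ x x0 (idx0 x x0)) := @au 0%N.
  exists (u 0%N x0), (e 1%N); split => //.
  - by have [] := e_is 1%N.
  - move=> x; rewrite huE u0 -[RHS]mulr1; congr (_ * _); apply: EFin_inj.
    rewrite (condexp_trivial (@mFF 0) (M_charges hP0 0) (fun z => idx0 z x)
      (iX P0 hP0) X0).
    exact: X1.
  - by move=> x; rewrite huE; apply: ler_wpM2r => //; rewrite -(u0 x).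
  - move=> P MP; have e1E : e 1%N = condexp P (FF 1) X.
      apply/esym/(condexp_transfer FF_mono mFF (M_charges MP) (M_charges hP0)
        (proportional MP)) => //;
        exact: iX.
    have [_ _] := condexpP (@mFF 1) (M_charges MP 1) (iX P MP) X0.
    by move=> /(_ setT (FFsetT 1)); rewrite e1E X1.
have [a /choice[e ae]] := choice step.
pose g x := \sum_(i < n) C i * (a i * e i x) - f 1 x.
have ah i m x y : idx m x = idx m y -> h i m x = h i m y.
  by have [xi _ [ahi _]] := hV i; move: x y; apply/measurable_wrt_indexP;
    exact: ahi.
have fhE m x : f m x = \sum_(i < n) C i * h i m x.
  apply: (ae_everywhere (@mFF m) (M_charges hP0 m) _ (fE m P0 hP0)) => y z yz.
  have /measurable_wrt_indexP/(_ y z yz)-> := @f_adapted m => ->.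
  by apply: eq_bigr => i _; rewrite (ah i m y z yz).
have me i : measurable_fun setT (e i).
  by have [ei _ _ _ _] := ae i; exact: (measurable_wrt_fun (@mFF 1) ei).
exists g; split.
- apply/measurable_wrt_indexP => x y xy; rewrite /g.
  have /measurable_wrt_indexP/(_ x y xy)-> := @f_adapted 1%N; congr (_ - _).
  apply: eq_bigr => i _; have [/measurable_wrt_indexP/(_ x y xy)-> _ _ _ _] :=
    ae i.
  by [].
- move=> x; rewrite /g subr_ge0 fhE; apply: ler_sum => i _.
  by apply: ler_wpM2l => //; have [_ _ _ + _] := ae i; apply.
move=> P x MP.
have ie i : P.-integrable setT (EFin \o e i).
  have [_ ei0 _ _ ei1] := ae i; apply: integrable_ge0 => //.
  by rewrite ei1// ltry.
have ige i : P.-integrable setT (fun y => ((C i * a i)%:E * (e i y)%:E)%E).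
  exact: (integrableZl measurableT (C i * a i) (ie i)).
have sumE : (\int[P]_y (\sum_(i < n) (C i * a i)%:E * (e i y)%:E) =
  (f 0 x)%:E)%E.
  rewrite integral_sum//.
  rewrite fhE -sumEFin; apply: eq_bigr => i _.
  rewrite integralZl//; last exact: ie.
  have [_ _ hi0 _ ei1] := ae i.
  by rewrite ei1// mule1 hi0.
have isum : P.-integrable setT
    (fun y => (\sum_(i < n) (C i * a i)%:E * (e i y)%:E))%E.
  by apply: integrable_sum => // i _; exact: ige.
have gE y : (g y)%:E =
    ((\sum_(i < n) (C i * a i)%:E * (e i y)%:E) - (f 1 y)%:E)%E.
  rewrite /g EFinB; congr (_ - _)%E; rewrite -sumEFin.
  by apply: eq_bigr => j _; rewrite -EFinM mulrA.
have -> : (\int[P]_y (g y)%:E =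
    \int[P]_y ((\sum_(i < n) (C i * a i)%:E * (e i y)%:E) - (f 1 y)%:E))%E.
  by apply: eq_integral => y _; exact: gE.
rewrite integralB//; last exact: f_int.
rewrite sumE addeC subeK//.
by apply: integrable_fin_num => //; exact: f_int.
Qed.

(** * The martingale f + S *)

Section decomposition.
Variable g1 : T -> R.
Hypothesis hg1 : first_compensator g1.

Let g1_known : measurable_wrt (FF 1) g1.
Proof. by case: hg1. Qed.

Let g1_ge0 x : 0 <= g1 x.
Proof. by case: hg1. Qed.

Let g1E P x : M P ->
  (\int[P]_y (f 1 y)%:E + \int[P]_y (g1 y)%:E = (f 0 x)%:E)%E.
Proof. by case: hg1 => _ _; exact. Qed.

Notation E k X := (condexp P0 (FF k) X).

Let E_is k m : is_condexp P0 (FF k) (f m) (E k (f m)).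
Proof. by apply: condexpP => //; [exact: M_charges|exact: f_int]. Qed.

Let E_ge0 k m x : 0 <= E k (f m) x.
Proof. by apply: condexp_ge0 => //; [exact: M_charges|exact: f_int]. Qed.

Let E_meas k m : measurable_fun setT (E k (f m)).
Proof. by have [/(measurable_wrt_fun (@mFF k))] := E_is k m. Qed.

Lemma condexp_f P k m : M P -> (0 < k)%N -> condexp P (FF k) (f m) = E k (f m).
Proof.
move=> MP k0; apply: condexp_transfer => //;
  [exact: M_charges|exact: M_charges|exact: proportional|..];
  exact: f_int.
Qed.

(** Doob's increments from the second step on; the first one is a free
    F_1-measurable function, because f_0 - E^P f_1 may vary with P. *)
Definition gain m : T -> R :=
  match m with
  | 0 => cst 0
  | 1 => g1
  | n.+2 => fun x => f n.+1 x - E n.+1 (f n.+2) x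
  end.

Notation S := (running_sum gain).

Notation N := (compensated f gain).

Lemma gain_ge0 m x : 0 <= gain m x.
Proof. by case: m => [//|[//|n]]; rewrite /= subr_ge0; exact: f_super. Qed.

#[local] Hint Resolve gain_ge0 : core.

Lemma gain_predictable m : measurable_wrt (FF m.+1) (gain m.+2).
Proof.
apply/measurable_wrt_indexP => x y xy /=; congr (_ - _).
  by move/measurable_wrt_indexP : (@f_adapted m.+1); exact.
by have [/measurable_wrt_indexP EE _ _] := E_is m.+1 m.+2; exact: EE.
Qed.

Lemma gain_adapted : adapted FF gain.
Proof.
case=> [|[//|n]]; first exact/measurable_wrt_indexP.
exact: (measurable_wrt_mono FF_mono (leqnSn _) (@gain_predictable n)).
Qed.

Let S_ge0 m x : 0 <= S m x.
Proof. exact/running_sum_ge0/gain_ge0. Qed.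

Let S_adapted : adapted FF S.
Proof. exact: (running_sum_adapted FF_mono (@gain_adapted)). Qed.

Lemma compensated_ge0 m x : 0 <= N m x.
Proof. by rewrite addr_ge0// S_ge0. Qed.

#[local] Hint Resolve compensated_ge0 : core.

Lemma compensated_adapted : adapted FF N.
Proof.
move=> m; apply/measurable_wrt_indexP => x y xy; rewrite /compensated.
have /measurable_wrt_indexP/(_ x y xy)-> := @f_adapted m.
by have /measurable_wrt_indexP/(_ x y xy)-> := @S_adapted m.
Qed.

Let S_meas m : measurable_fun setT (S m).
Proof. exact: (measurable_wrt_fun (@mFF m) (@S_adapted m)). Qed.

Let gain_meas m : measurable_fun setT (gain m).
Proof. exact: (measurable_wrt_fun (@mFF m) (@gain_adapted m)). Qed.

Let N_meas m : measurable_fun setT (N m).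
Proof. exact: (measurable_wrt_fun (@mFF m) (@compensated_adapted m)). Qed.

Let g1_meas : measurable_fun setT g1.
Proof. exact: (measurable_wrt_fun (@mFF 1) g1_known). Qed.

(** At the first step this is the property of g1; at the later ones the
    conditional expectation under P0 used in [gain] is also that under P. *)
Lemma compensated_step P n B : M P -> FF n B ->
  (\int[P]_(x in B) (N n.+1 x)%:E
    = \int[P]_(x in B) (N n x)%:E)%E.
Proof.
move=> MP FB; have mB := mFF FB; case: n FB => [|n] FB.
  have [->|->] := initial_sets idx0 FB; first by rewrite !integral_set0.
  transitivity (\int[P]_y (f 1 y + g1 y)%:E)%E.
    apply: eq_integral => x _.
    by rewrite /compensated running_sumS running_sum0 add0r.
  rewrite integral_ge0D//.
  have [x _] := probability_inhabited P.
  rewrite (g1E x MP).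
  rewrite (integral_initial idx0 P x (@compensated_adapted 0)).
  by rewrite /compensated running_sum0 addr0.
transitivity (\int[P]_(x in B) (f n.+2 x)%:E
    + \int[P]_(x in B) (S n.+1 x + gain n.+2 x)%:E)%E.
  rewrite -integral_ge0D//.
  - by apply: eq_integral => x _; rewrite /compensated running_sumS.
  - exact: measurable_funD.
  - by move=> x; rewrite addr_ge0 ?S_ge0 ?gain_ge0.
have -> : (\int[P]_(x in B) (f n.+2 x)%:E
    = \int[P]_(x in B) (E n.+1 (f n.+2) x)%:E)%E.
  have [_ _] := condexpP (@mFF n.+1) (M_charges MP n.+1) (f_int n.+2 MP)
    (f_ge0 n.+2).
  by move=> /(_ _ FB) <-; rewrite condexp_f.
rewrite -integral_ge0D//.
- apply: eq_integral => x _; congr EFin; rewrite /compensated.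
  by rewrite /= addrCA [E _ _ _ + _]addrC subrK addrC.
- exact: measurable_funD.
- by move=> x; rewrite addr_ge0 ?S_ge0 ?gain_ge0.
Qed.

Lemma compensated_martingale P : M P -> set_martingale idx P N.
Proof.
move=> MP k m B; elim: m => [|m IHm]; first by rewrite leqn0 => /eqP->.
rewrite leq_eqVlt ltnS => /orP[/eqP->//|km] FB.
by rewrite compensated_step ?IHm//; exact: FF_mono FB.
Qed.

Let gain0 x : gain 0 x = 0.
Proof. by []. Qed.

(** * From the condition to local regularity *)

Lemma f_mean_le P m x : M P -> (\int[P]_y (f m y)%:E <= (f 0 x)%:E)%E.
Proof.
move=> MP; have -> : f 0 x = N 0 x.
  by rewrite /compensated running_sum0 gain0 addr0.
rewrite -(mart_mean idx0 (compensated_martingale MP) compensated_adapted m x).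
by apply: integral_ge0_le => // y; rewrite /compensated lerDl.
Qed.

Lemma gain_int P m : M P -> P.-integrable setT (EFin \o gain m).
Proof.
move=> MP; apply: integrable_ge0 => //; have [x _] := probability_inhabited P.
apply: (@le_lt_trans _ _ (\int[P]_y (N m y)%:E)%E); last first.
  by rewrite (mart_mean idx0 (compensated_martingale MP) compensated_adapted m
    x) ltry.
apply: integral_ge0_le => // y; apply: ler_wpDl => //.
rewrite /running_sum big_ord_recr/= lerDr; apply: sumr_ge0 => j _.
exact: gain_ge0.
Qed.

(** The increments of S have the conditional expectation of the drift of f; for
    m = 1 they need not be predictable and only this much is true. *)
Lemma condexp_gain P n x : M P -> condexp P (FF n) (gain n.+1) x =
  f n x - condexp P (FF n) (f n.+1) x.
Proof.
move=> MP; have FC := index_sets_cell (idx n) x; have mC := mFF FC.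
have := compensated_martingale MP (leqnSn n) FC.
rewrite [RHS]integral_cell//; last exact: compensated_adapted.
have -> : (\int[P]_(y in cell (idx n) x) (N n.+1 y)%:E =
    \int[P]_(y in cell (idx n) x) (f n.+1 y)%:E +
    (\int[P]_(y in cell (idx n) x) (running_sum gain n y)%:E +
     \int[P]_(y in cell (idx n) x) (gain n.+1 y)%:E))%E.
  rewrite -!integral_ge0D//;
    [|exact: measurable_funD|by move=> y; rewrite addr_ge0..].
  by apply: eq_integral => y _; rewrite /compensated running_sumS.
rewrite (integral_cell _ _ _ (@S_adapted n))//.
rewrite -(condexp_cell (@mFF n) (M_charges MP n) x (f_int n.+1 MP)
  (f_ge0 n.+1)).
rewrite -(condexp_cell (@mFF n) (M_charges MP n) x (gain_int n.+1 MP)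
  (gain_ge0 n.+1)).
rewrite (cell_massE (@mFF n)) -!EFinM -!EFinD => -[].
rewrite /compensated -!mulrDl =>
  /(mulIf (lt0r_neq0 (cell_mass_gt0 (@mFF n) (M_charges MP n) x))).
move=> H; apply/eqP; rewrite -subr_eq opprK; move/eqP: H.
by rewrite addrCA [f n x + _]addrC (inj_eq (addrI _)) addrC.
Qed.

Lemma supermartingale_stopped k : supermartingale FF M (stopped f k).
Proof.
split; first exact: stopped_adapted.
- move=> P m MP _; rewrite unlock /stopped.
  by have /integrableP[_] := f_int (minn m k) MP.
- move=> P j m MP jm; apply: aeW => x; rewrite /stopped.
  have [jk|kj] := leqP j k.
    by apply: f_super => //; rewrite leq_min jm.
  rewrite (minn_idPr (ltnW (leq_trans kj jm))).
  rewrite condexp_known//; [exact: M_charges| |exact: f_int].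
  exact: (measurable_wrt_mono FF_mono (ltnW kj) (@f_adapted k)).
Qed.

(** The finite sum f_0 + ... + f_k dominates the stopped process, and each term
    has mean at most f_0 under every measure. *)
Lemma uniformly_dominated_stopped k : uniformly_dominated M (stopped f k).
Proof.
have [x0 _] := probability_inhabited P0.
exists (fun x => \sum_(m < k.+1) f m x), (f 0 x0 *+ k.+1 + 1); split.
- by apply: measurable_sum => m.
- move=> m Q _; apply: aeW => x; rewrite /stopped ger0_norm//.
  have mk : (minn m k < k.+1)%N by rewrite ltnS geq_minr.
  rewrite (bigD1 (Ordinal mk))//= lerDl.
  by apply: sumr_ge0 => *; exact: f_ge0.
- move=> Q MQ; rewrite unlock.
  under eq_integral do rewrite -sumEFin.
  rewrite ge0_integral_sum//; last 2 first.
  + by move=> m; exact/measurable_EFinP.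
  + by move=> m x _; rewrite lee_fin.
  apply: (@le_lt_trans _ _ (f 0 x0 *+ k.+1)%:E); last by rewrite lte_fin ltrDl.
  rewrite -[X in _ *+ X]card_ord -sumr_const -sumEFin.
  by apply: lee_sum => m _; exact: f_mean_le.
Qed.

Let condexp_gain_index P n x y : M P -> idx n x = idx n y ->
  condexp P (FF n) (gain n.+1) x = condexp P (FF n) (gain n.+1) y.
Proof.
move=> MP; have [/measurable_wrt_indexP cxy _ _] :=
  condexpP (@mFF n) (M_charges MP n) (gain_int n.+1 MP) (gain_ge0 n.+1).
exact: cxy.
Qed.

(** The least of the drifts of f under the measures of the family is positive at
    x0: the gain is positive on the block of x0, which all of them charge. *)
Lemma joint_drift s (Ph : 'I_s.+1 -> probability T R) n x0 :
  (forall i, M (Ph i)) -> 0 < gain n.+1 x0 ->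
  exists phi : T -> R,
    [/\ measurable_wrt (FF n) phi, forall x, 0 <= phi x,
        (0 < Ph ord0 [set x | (0 < phi x)%R])%E &
        forall i x, phi x <= f n x - condexp (Ph i) (FF n) (f n.+1) x].
Proof.
move=> MPh gx0; pose e i x := condexp (Ph i) (FF n) (gain n.+1) x.
pose phi x := \big[Num.min/e ord0 x]_(i < s.+1) e i x.
have phi_index x y : idx n x = idx n y -> phi x = phi y.
  move=> xy; rewrite /phi /e (condexp_gain_index (MPh ord0) xy).
  by apply: eq_bigr => i _; exact: condexp_gain_index.
have e0 i : 0 < e i x0.
  have := condexp_cell (@mFF n) (M_charges (MPh i) n) x0
    (gain_int n.+1 (MPh i)) (gain_ge0 n.+1).
  rewrite (cell_massE (@mFF n)) -EFinM => eE.
  rewrite -(pmulr_lgt0 _ (cell_mass_gt0 (@mFF n) (M_charges (MPh i) n) x0))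
    -lte_fin eE.
  have mC : measurable (cell (idx n) x0) by exact: measurable_cell.
  have mC1 : measurable (cell (idx n.+1) x0) by exact: measurable_cell.
  apply: (@lt_le_trans _ _
    (\int[Ph i]_(y in cell (idx n.+1) x0) (gain n.+1 y)%:E)%E).
    rewrite integral_cell//; last exact: gain_adapted.
    by rewrite mule_gt0// ?lte_fin//; exact: M_charges.
  apply: ge0_subset_integral => //.
  - exact/measurable_EFinP/measurable_funTS.
  - by move=> y _; rewrite lee_fin.
  - exact: (cell_sub (FF_mono (leqnSn n) (index_sets_cell _ _))).
exists phi; split.
- exact/measurable_wrt_indexP.
- move=> x; apply: le_bigmin => [|i _]; apply: condexp_ge0 => //;
    [exact: M_charges|exact: gain_int|exact: M_charges|exact: gain_int].
- apply: (@lt_le_trans _ _ (Ph ord0 (cell (idx n) x0))); first exact: M_charges.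
  apply: le_measure; rewrite ?inE.
  + exact: measurable_cell.
  + by apply/mFF/index_sets_invariant => x y /phi_index ->.
  + move=> y yx; rewrite /= (phi_index _ _ yx).
    by apply: lt_bigmin => [|i _]; exact: e0.
- by move=> i x; rewrite -condexp_gain//; exact: bigmin_le_cond.
Qed.

(** The process of the definition is the gain cut off after time k; its running
    sum is the stopped S and compensates f stopped at k under all measures. *)
Lemma regular_stopped k n x0 : (n < k)%N -> 0 < gain n.+1 x0 ->
  regular FF M (stopped f k).
Proof.
move=> nk gx0; split;
  [exact: supermartingale_stopped|exact: uniformly_dominated_stopped|].
pose gbar m := if (m <= k)%N then gain m else cst 0.
pose G := stopped (running_sum gain) k; pose Nk := stopped N k.
have G0 x : G 0 x = 0 by rewrite /G /stopped min0n running_sum0 gain0.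
have gbar_ge0 m x : 0 <= gbar m x by rewrite /gbar; case: ifP.
have Gstep m x : G m.+1 x - G m x = gbar m.+1 x.
  rewrite /G /stopped /gbar; case: (ltnP m k) => mk.
    by rewrite (minn_idPl mk) running_sumS addrC addKr.
  by rewrite (minn_idPr (leqW mk)) subrr.
have aG : adapted FF G by apply: stopped_adapted; exact: S_adapted.
have aNk : adapted FF Nk by apply: stopped_adapted; exact: compensated_adapted.
have Nk_ge0 m x : 0 <= Nk m x by exact: compensated_ge0.
exists gbar; split.
- move=> m; rewrite /gbar; case: ifP => _;
    [exact: gain_adapted|exact/measurable_wrt_indexP].
- by move=> m P _; exact: aeW.
- by move=> P _; apply: aeW => x; rewrite /gbar leq0n.
- move=> P m MP _; rewrite unlock /gbar; case: ifP => _; last first.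
    by rewrite integral0_eq.
  have /integrableP[_] := gain_int m MP.
  by under eq_integral do rewrite /= ger0_norm//.
move=> s Ph MPh _; split.
  have [phi [phi1 phi2 phi3 phi4]] := joint_drift MPh gx0.
  exists n.+1, phi; split => //.
  - by move=> P _; exact: aeW.
  - move=> i; apply: aeW => x; rewrite /stopped /=.
    by rewrite (minn_idPl (ltnW nk)) (minn_idPl nk).
(* mixtures charge the blocks and integrate the stopped N as their components
   do *)
have nice Q : mixtures Ph Q ->
    (forall j, charges_cells (idx j) Q) /\ set_martingale idx Q Nk.
  move=> [gam [gam0 gam1 QE]]; split.
    move=> j x; rewrite QE; last exact: measurable_cell.
    have [i gi] : exists i, 0 < gam i.
      apply: contrapT => /forallNP ng; move: gam1.
      rewrite big1 => [/esym/eqP|i _]; first by rewrite oner_eq0.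
      by apply/eqP; rewrite eq_le gam0 andbT leNgt; exact/negP/ng.
    rewrite (bigD1 i)//=;
      apply: (@lt_le_trans _ _ ((gam i)%:E * Ph i (cell (idx j) x))%E).
      by rewrite mule_gt0//; exact: M_charges.
    by rewrite leeDl// sume_ge0// => i' _; rewrite mule_ge0// lee_fin.
  move=> j m B jm FB; have mB := mFF FB.
  have mNk l : measurable_fun setT (Nk l) by exact: N_meas.
  rewrite !(integral_mixture gam0 QE)//; apply: eq_bigr => i _.
  by rewrite (stopped_mart k (compensated_martingale (MPh i)) jm).
have compG : compensators FF M Ph (stopped f k) G.
  split => //.
  - by move=> P _; exact: aeW.
  - by move=> m P _; apply: aeW => x; rewrite -subr_ge0 Gstep.
  - split => //.
    + move=> Q m /nice[_ Nm] _; rewrite unlock.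
      by have /integrableP[_] := mart_int idx0 mFF Nm aNk Nk_ge0 m.
    + move=> Q j m /nice[cQ Nm] jm; apply: aeW => x.
      by rewrite (mart_condexp idx0 mFF Nm aNk Nk_ge0 cQ jm).
have GG : process_le M G G.
  move=> P m _ _; rewrite (_ : [set x | _] = setT) ?probability_setT//.
  by apply/seteqP; split => // x _ /=; rewrite subrr.
have [C CG Cmax] := maximal_chain_through compG GG.
(* any larger compensator h in the chain has h = G: both f + h and f + G start
   at f_0, and the former is a supermartingale *)
exists C, G; split => //.
- split => // h Ch Gh P m MP m0.
  have [Csub _ _] := Cmax; have [ah h0 _ [_ hint hsup]] := Csub _ Ch.
  pose Q := Ph ord0; have MQ : M Q by exact: MPh.
  have mixQ : mixtures Ph Q by exact: mixture_component.
  have [_ NmQ] := nice _ mixQ.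
  have hGx x : h m x = G m x.
    suff: h m x - G m x = 0 by move/eqP; rewrite subr_eq0 => /eqP.
    have hG y : 0 <= h m y - G m y.
      apply: (sure_everywhere (@mFF m) (M_charges MQ m) _ (Gh Q m MQ m0)) =>
        {}y z yz.
      have /measurable_wrt_indexP/(_ y z yz)-> := @ah m.
      by have /measurable_wrt_indexP/(_ y z yz)-> := @aG m.
    pose D y := h m y - G m y.
    have aD : measurable_wrt (FF m) D.
      apply/measurable_wrt_indexP => y z yz; rewrite /D.
      have /measurable_wrt_indexP/(_ y z yz)-> := @ah m.
      by have /measurable_wrt_indexP/(_ y z yz)-> := @aG m.
    have mD := measurable_wrt_fun (@mFF m) aD.
    have mNk : measurable_fun setT (Nk m) by exact: N_meas.
    apply: (integral_ge0_eq0 (@mFF m) (M_charges MQ m) aD hG).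
    pose X y := stopped f k m y + h m y.
    have XE y : X y = Nk m y + D y.
      rewrite /X /D -[Nk m y]/(stopped f k m y + G m y) -addrA.
      by rewrite [G m y + _]addrC subrK.
    have X0 y : 0 <= X y by rewrite XE addr_ge0//; exact: hG.
    have iX : Q.-integrable setT (EFin \o X).
      have XX : X = Nk m \+ D by exact/funext.
      apply/integrableP; split; last by have := hint Q m mixQ m0;
        rewrite unlock.
      rewrite XX.
      exact/measurable_EFinP/measurable_funD.
    have h0x : h 0%N x = 0.
      apply: (ae_everywhere (@mFF 0) (M_charges MQ 0) _ (h0 Q MQ)) => y z yz.
      by have /measurable_wrt_indexP/(_ y z yz)-> := @ah 0%N.
    have : condexp Q (FF 0) X x <= stopped f k 0 x + h 0%N x.
      apply: (ae_everywhere (@mFF 0) (M_charges MQ 0) _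
        (hsup Q 0%N m mixQ (leq0n m))).
      move=> y z yz; have /measurable_wrt_indexP/(_ y z yz)-> := @ah 0%N.
      rewrite /stopped min0n; have /measurable_wrt_indexP/(_ y z yz)-> :=
        @f_adapted 0%N.
      have [/measurable_wrt_indexP cyz _ _] :=
        condexpP (@mFF 0) (M_charges MQ 0) iX X0.
      by rewrite (cyz y z yz).
    rewrite -lee_fin (condexp_trivial (@mFF 0) (M_charges MQ 0)
      (fun y => idx0 y x) iX X0).
    rewrite h0x addr0 /stopped min0n; under eq_integral do rewrite XE.
    rewrite integral_ge0D// (mart_mean idx0 NmQ aNk m x).
    rewrite /Nk /stopped min0n /compensated running_sum0 gain0 addr0.
    by rewrite -[leRHS]adde0 leeD2lE.
  rewrite (_ : [set y | _] = setT) ?probability_setT//.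
  by apply/seteqP; split => // y _ /=; rewrite hGx subrr.
- move=> i j m _ jm; apply: aeW => x.
  have [cQ Nm] := nice _ (mixture_component Ph i).
  by have -> := mart_condexp idx0 mFF Nm aNk Nk_ge0 cQ jm.
- move=> i [//|m] _; apply: aeW => x /=.
  by rewrite (_ : (fun y => _) = gbar m.+1)//; apply/funext => y.
Qed.

(** Stopping at any time from n + 1 on keeps the positive increment. *)
Lemma local_regular_of_gain n x0 : 0 < gain n.+1 x0 -> local_regular FF M f.
Proof.
move=> gx0; split.
- split => //.
  + move=> P m MP _; rewrite unlock.
    by have /integrableP[_] := f_int m MP.
  + by move=> P k m MP km; apply: aeW => x; exact: f_super.
- move=> m; apply: (@le_lt_trans _ _ (f 0 x0)%:E); last by rewrite ltry.
  apply: ub_ereal_sup => _ [P MP <-]; rewrite unlock.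
  under eq_integral do rewrite ger0_norm//.
  exact: f_mean_le.
- exists (fun s => n.+1 + s)%N; split.
  + by move=> a b; rewrite leEnat leq_add2l.
  + apply/cvgnyPge => B; near=> s.
    by rewrite (leq_trans _ (leq_addl _ _))//; near: s; exact: nbhs_infty_ge.
  + by move=> s; apply: (@regular_stopped _ n x0); rewrite ?ltn_addr.
Unshelve. all: by end_near.
Qed.

(** * From the condition to K *)

Let S_mono x : {homo S^~ x : k m / (k <= m)%N >-> k <= m}.
Proof.
by apply: (homo_leq (r := fun a b => a <= b)) => [//|a b c /le_trans|m];
  [apply|rewrite running_sumS lerDl].
Qed.

Let N_mean P m x : M P -> (\int[P]_y (N m y)%:E = (f 0 x)%:E)%E.
Proof.
move=> MP; rewrite (mart_mean idx0 (compensated_martingale MP)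
  compensated_adapted m x).
by rewrite /compensated running_sum0 gain0 addr0.
Qed.

Hypothesis fui : uniformly_integrable P0 f.

(** For n >= m and B in F_m the integrals of f_n and of S_n over B add up to
    that of N_m. Along an ultrafilter the former tend to the integrals of a
    density r, the latter increase to the integrals of the limit of S. *)
Lemma closing_variable_P0 : exists z : T -> R,
  [/\ measurable_fun setT z, forall x, 0 <= z x &
   forall m B, FF m B -> (\int[P0]_(x in B) (z x)%:E
                          = \int[P0]_(x in B) (N m x)%:E)%E].
Proof.
have [x0 _] := probability_inhabited P0.
have NI m B : measurable B -> (\int[P0]_(x in B) (N m x)%:E <= (f 0 x0)%:E)%E.
  move=> mB; rewrite -(N_mean m x0 hP0); apply: ge0_subset_integral => //.
    exact/measurable_EFinP.
  by move=> x _; rewrite lee_fin.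
have fI m : (\int[P0]_x (f m x)%:E <= (f 0 x0)%:E)%E.
  apply: le_trans (NI m setT measurableT).
  by apply: integral_ge0_le => // x; rewrite /compensated lerDl.
have SI m B : measurable B -> (\int[P0]_(x in B) (S m x)%:E <= (f 0 x0)%:E)%E.
  move=> mB; apply: le_trans (NI m B mB).
  by apply: integral_ge0_le => // x; rewrite /compensated lerDr.
have fin (g : T -> \bar R) B : (forall x, (0 <= g x)%E) ->
    (\int[P0]_(x in B) g x <= (f 0 x0)%:E)%E ->
    (\int[P0]_(x in B) g x)%E \is a fin_num.
  move=> g0 gI; rewrite ge0_fin_numE ?(le_lt_trans gI) ?ltry//.
  by apply: integral_ge0 => x _; exact: g0.
have [U [UU ooU]] := ultraFilterLemma (@eventually_filter : ProperFilter \oo).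
have [r [r0 ir rlim]] := limit_density f_meas f_ge0 fui fI UU.
pose gam x := limn (fun n => (S n x)%:E).
have gam0 x : (0 <= gam x)%E.
  apply: lime_ge; last by apply: nearW => n; rewrite lee_fin.
  by apply: ereal_nondecreasing_is_cvgn => k m km; rewrite lee_fin S_mono.
have mgam : measurable_fun setT gam.
  apply: (emeasurable_fun_cvg (fun n x => (S n x)%:E)) => [n|x _].
    exact/measurable_EFinP.
  by apply: ereal_nondecreasing_is_cvgn => k m km; rewrite lee_fin S_mono.
have gam_cvg B : measurable B ->
    (\int[P0]_(x in B) (S n x)%:E @[n --> \oo] --> \int[P0]_(x in B) gam x)%E.
  move=> mB; apply: cvg_monotone_convergence => //.
  - by move=> n; exact/measurable_EFinP/measurable_funTS.
  - by move=> n x _; rewrite lee_fin.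
  - by move=> x _ k m km; rewrite lee_fin S_mono.
have gamI B : measurable B -> (\int[P0]_(x in B) gam x <= (f 0 x0)%:E)%E.
  move=> mB; rewrite -(cvg_lim _ (gam_cvg _ mB))//; apply: lime_le.
    by apply/cvg_ex; exists (\int[P0]_(x in B) gam x)%E; exact: gam_cvg.
  by apply: nearW => n; exact: SI.
have mr : measurable_fun setT r by exact: measurable_int ir.
have sumE m B : FF m B ->
    (\int[P0]_(x in B) (r x + gam x) = \int[P0]_(x in B) (N m x)%:E)%E.
  move=> FB; have mB := mFF FB.
  rewrite ge0_integralD//; [|exact: measurable_funTS..].
  have rfin : (\int[P0]_(x in B) r x)%E \is a fin_num.
    apply: integrable_fin_num => //; exact: integrableS ir.
  have gfin := fin gam B gam0 (gamI B mB).
  have Nfin : (\int[P0]_(x in B) (N m x)%:E)%E \is a fin_num.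
    by apply: (fin (fun x => (N m x)%:E) B) (NI m B mB) => x; rewrite lee_fin.
  rewrite -(fineK rfin) -(fineK gfin) -(fineK Nfin) -EFinD; congr EFin.
  apply: (@cvg_unique _ (@Rhausdorff R)
    (fine (\int[P0]_(x in B) (f n x)%:E)%E
       + fine (\int[P0]_(x in B) (S n x)%:E)%E @[n --> U])).
    apply: cvgD; first exact: rlim.
    apply: cvg_trans; last first.
      apply: (@fine_cvg _ _ \oo); rewrite fineK//; exact: gam_cvg.
    by apply: cvg_app.
  apply: cvg_near_cst; apply: ooU; near=> n.
  have mn : (m <= n)%N by near: n; exact: nbhs_infty_ge.
  have fF : (\int[P0]_(x in B) (f n x)%:E)%E \is a fin_num.
    apply: (fin (fun x => (f n x)%:E)) => [x|]; first by rewrite lee_fin.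
    apply: le_trans (NI n B mB).
    by apply: integral_ge0_le => // x; rewrite /compensated lerDl.
  have SF : (\int[P0]_(x in B) (S n x)%:E)%E \is a fin_num.
    by apply: (fin (fun x => (S n x)%:E) B) (SI n B mB) => x; rewrite lee_fin.
  by rewrite -(compensated_martingale hP0 mn FB) integral_ge0D// (fineD fF SF).
exists (fun x => fine (r x + gam x)); split.
- apply: measurableT_comp => //; exact: emeasurable_funD.
- by move=> x; rewrite fine_ge0// adde_ge0.
- move=> m B FB; rewrite -(sumE m B FB); have mB := mFF FB.
  apply: ae_eq_integral => //.
  + exact/measurable_EFinP/measurableT_comp/measurable_funTS/emeasurable_funD.
  + exact/measurable_funTS/emeasurable_funD.
  have isum : P0.-integrable setT (fun x => r x + gam x)%E.
    apply/integrableP; split; first exact: emeasurable_funD.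
    under eq_integral do rewrite gee0_abs ?adde_ge0//.
    rewrite (sumE 0%N); last by exists setT.
    by rewrite (N_mean 0 x0 hP0) ltry.
  have := integrable_ae measurableT isum.
  by apply: filterS => x /(_ Logic.I) xf _; rewrite fineK.
Unshelve. all: by end_near.
Qed.

(** The equations transfer from P0 to P in F_m for m >= 1, and hold for m = 0
    because N is a martingale under P. *)
Lemma closing_variable : exists z : T -> R,
  [/\ measurable_fun setT z, forall x, 0 <= z x &
   forall P m B, M P -> FF m B -> (\int[P]_(x in B) (z x)%:E
                          = \int[P]_(x in B) (N m x)%:E)%E].
Proof.
have [z [mz z0 zE]] := closing_variable_P0; exists z; split => // P m B MP.
have zP n C : (0 < n)%N -> FF n C -> (\int[P]_(x in C) (z x)%:E
                          = \int[P]_(x in C) (N n x)%:E)%E.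
  move=> n0; apply: (transfer_integrals FF_mono mFF (proportional MP)) => //.
  exact: zE.
case: m => [|m] FB; last exact: zP.
rewrite (zP 1%N) ?(compensated_martingale MP (leq0n 1))//.
exact: FF_mono FB.
Qed.

Let one_known m : measurable_wrt (FF m) (cst (1 : R)).
Proof. exact/measurable_wrt_indexP. Qed.

Let one_int (P : probability T R) : (\int[P]_x (cst (1 : R) x)%:E = 1)%E.
Proof. exact: (integral_cst_probability P 1%E). Qed.

(** Normalization of the closing variable by its mean f_0; if f_0 = 0, then N
    vanishes and any density will do. *)
Lemma closed_martingale : exists (xi : T -> R) (h : nat -> T -> R),
  [/\ G0 M xi, adapted FF h,
      forall P m, M P -> condexp P (FF m) xi = h m &
      forall m x, f 0 x * h m x = N m x].
Proof.
have [x0 _] := probability_inhabited P0.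
have f0E x : f 0 x = f 0 x0.
  have /measurable_wrt_indexP f0 := @f_adapted 0; exact/f0/idx0.
have [fx0|fx0] := eqVneq (f 0 x0) 0.
  exists (cst 1), (fun=> cst 1); split => //.
  - split => //.
    + by move=> P _; apply: aeW => x; rewrite /cst.
    + by move=> P _; rewrite unlock.
  - move=> P m MP; apply: condexp_known => //; first exact: M_charges.
    by apply: integrable_ge0; rewrite ?one_int ?ltry//; move=> x; rewrite /cst.
  - move=> m x; rewrite f0E fx0 mul0r.
    rewrite (integral_ge0_eq0 (@mFF m) (M_charges hP0 m)
      (@compensated_adapted m))//.
    by rewrite (N_mean m x0 hP0) fx0.
have fpos : 0 < (f 0 x0)^-1 by rewrite invr_gt0 lt0r fx0 f_ge0.
have [z [mz z0 zE]] := closing_variable.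
pose k := (f 0 x0)^-1; pose xi x := k * z x; pose h m x := k * N m x.
have mxi : measurable_fun setT xi by exact: measurable_funM.
have xi0 x : 0 <= xi x by rewrite mulr_ge0// ltW.
have h_adapted : adapted FF h.
  move=> m; apply/measurable_wrt_indexP => x y xy; rewrite /h.
  by have /measurable_wrt_indexP/(_ x y xy)-> := @compensated_adapted m.
have mh m : measurable_fun setT (h m).
  exact: (measurable_wrt_fun (@mFF m) (@h_adapted m)).
have xihE P m B : M P -> FF m B ->
    (\int[P]_(x in B) (h m x)%:E = \int[P]_(x in B) (xi x)%:E)%E.
  move=> MP FB; have mB := mFF FB.
  by rewrite !integral_ge0Z ?(ltW fpos)//; congr (_ * _)%E; rewrite (zE P m).
have hI P m : M P -> (\int[P]_x (h m x)%:E = 1)%E.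
  move=> MP; rewrite integral_ge0Z ?(ltW fpos)// (N_mean m x0 MP).
  by rewrite -EFinM mulVf.
exists xi, h; split => //.
- split => //; first by move=> P _; exact: aeW.
  by move=> P MP; rewrite unlock -(xihE P 0%N)// hI.
- move=> P m MP; apply: condexp_unique => //; first exact: M_charges.
  split=> // => [|B FB]; last exact: xihE.
  apply: integrable_ge0 => //; first by move=> x; rewrite mulr_ge0// ltW.
  by rewrite hI// ltry.
- by move=> m x; rewrite f0E /h mulVKf.
Qed.

(** f = f_0 (1 E{xi | F_m}) + 1 (- S_m E{1 | F_m}). *)
Lemma K_of_gain : K_ FF M f.
Proof.
have [x0 _] := probability_inhabited P0.
have [xi [h [xiG ah hE Nh]]] := closed_martingale.
have [mxi _ xi1] := xiG.
split => //; exists 2%N, (fun i : 'I_2 => if i == ord0 then f 0 x0 else 1),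
  (fun i : 'I_2 => if i == ord0 then h else (fun m x => - S m x)).
split => //.
- by move=> i; case: ifP.
- move=> i; case: ifP => _.
    exists xi => //; split => //; exists (fun=> cst 1); last split.
    + split; first by move=> m; exact: one_known.
      by move=> m P _; apply: aeW => x.
    + move=> Q m MQ _; rewrite (_ : (fun x => _) = xi) ?xi1 ?ltry//.
      by apply/funext => x; rewrite normr1 mulr1.
    + by move=> P m MP; apply: aeW => x; rewrite hE// mul1r.
  exists (cst 1).
    split => //; first by move=> P _; apply: aeW => x; rewrite /cst.
    by move=> P _; rewrite unlock.
  have aS : adapted FF (fun m x => - S m x).
    move=> m; apply/measurable_wrt_indexP => x y xy.
    by have /measurable_wrt_indexP/(_ x y xy)-> := @S_adapted m.
  split => //; exists (fun m x => - S m x); last split.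
  + split => // m P _; apply: aeW => x.
    by rewrite lerN2 S_mono.
  + move=> Q m MQ _; rewrite unlock.
    under eq_integral do rewrite /cst mul1r normrN ger0_norm//.
    apply: (@le_lt_trans _ _ (f 0 x0)%:E); last by rewrite ltry.
    rewrite -(N_mean m x0 MQ); apply: integral_ge0_le => // x.
    by rewrite /compensated lerDr.
  + move=> P m MP; apply: aeW => x.
    rewrite condexp_known ?mulr1//; first exact: M_charges.
    by apply: integrable_ge0; rewrite ?one_int ?ltry//; move=> y; rewrite /cst.
- move=> m P _; apply: aeW => x.
  rewrite big_ord_recl big_ord1/= mul1r.
  have -> : f 0 x0 = f 0 x.
    have /measurable_wrt_indexP f0 := @f_adapted 0; exact/f0/idx0.
  by rewrite Nh /compensated addrK.
Qed.

End decomposition.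

(** If no gain were positive, S would vanish and f would be the martingale N. *)
Lemma local_regular_iff_K : ~ martingale FF M f -> uniformly_integrable P0 f ->
  local_regular FF M f <-> K_ FF M f.
Proof.
move=> nm fui; split=> [fl|fK].
  have [g1 hg1] := first_compensator_of_local_regular fl.
  exact: (K_of_gain hg1 fui).
have [g1 hg1] := first_compensator_of_K fK.
have [[n [x gx]]|nogain] := pselect (exists n x, 0 < gain g1 n.+1 x).
  exact: (local_regular_of_gain hg1 gx).
exfalso; apply: nm.
have gain_eq0 n x : gain g1 n x = 0.
  case: n => [//|n]; apply/eqP; rewrite eq_le gain_ge0// andbT leNgt.
  by apply/negP => gx; apply: nogain; exists n, x.
have NE m : compensated f (gain g1) m = f m.
  by apply/funext => x; rewrite /compensated /running_sum big1 ?addr0.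
split => //.
- move=> P m MP _; rewrite unlock.
  by have /integrableP[_] := f_int m MP.
- move=> P k m MP km; apply: aeW => x.
  have := mart_condexp idx0 mFF (compensated_martingale hg1 MP)
    (@compensated_adapted _ hg1) (compensated_ge0 hg1) (M_charges MP) km.
  by rewrite !NE => ->.
Qed.

End process.
End stable_model.

(** * The equivalence *)
Theorem theorem11 (R : realType) (d : measure_display) (T : measurableType d)
    (FF : nat -> set (set T)) (A : nat -> nat -> set T)
    (I : nat -> nat -> set nat)
    (M : set (probability T R)) (P0 : probability T R) (f : nat -> T -> R)
    (hFF : filtration FF) (hA : condition_A FF A I)
    (hconv : convex_family M) (hequiv : equivalent_family M)
    (hpos : forall P n s, M P -> (0 < n)%N -> (0 < P (A n s))%E)
    (hP0 : M P0)
    (hratio : forall P n s j, M P -> (0 < n)%N -> I n s j ->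
       fine (P (A n.+1 j)) / fine (P (A n s))
         <= fine (P0 (A n.+1 j)) / fine (P0 (A n s)))
    (hf : supermartingale FF M f)
    (hf0 : forall m, all_as M (fun x => 0 <= f m x))
    (hui : forall P, M P -> uniformly_integrable P f)
    (hnm : ~ martingale FF M f) :
  local_regular FF M f <-> K_ FF M f.
Proof.
have FFE : FF = fun n => index_sets (block_index A n).
  by apply/funext => n; exact: (filtration_index hFF hA).
pose idx := block_index A.
have idx0 x y : idx 0%N x = idx 0%N y by [].
have FF_mono k m : (k <= m)%N -> index_sets (idx k) `<=` index_sets (idx m).
  by move=> km; rewrite -!(filtration_index hFF hA); exact: filtration_mono.
have mFF n : index_sets (idx n) `<=` measurable.
  exact: (filtration_measurable hFF hA).
have M_charges P : M P -> forall n, charges_cells (idx n) P.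
  by move=> MP; apply: (charges_block_cells hA) => n s; exact: hpos.
have proportional P : M P -> forall x, exists c : R, 0 <= c /\
    forall B, measurable B -> B `<=` cell (idx 1%N) x -> P B = (c%:E * P0 B)%E.
  move=> MP x; exists (fine (P (A 1%N (idx 1%N x))) / fine
    (P0 (A 1%N (idx 1%N x)))).
  split; first by rewrite divr_ge0// fine_ge0.
  move=> B mB Bx; apply: (proportional_on_first_cell hFF hA) => //.
  - by move=> n s; exact: hpos.
  - by move=> n s; exact: hpos.
  - by move=> n s j; exact: hratio.
rewrite FFE in hf hnm *; have [f_adapted f_fin f_super] := hf.
have f_index m x y : idx m x = idx m y -> f m x = f m y.
  by move: x y; apply/measurable_wrt_indexP; exact: f_adapted.
have f_ge0 m x : 0 <= f m x.
  by apply: (ae_everywhere (@mFF m) (M_charges _ hP0 m) _ (hf0 m P0 hP0)) =>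
    y z /f_index ->.
have f_int P m : M P -> P.-integrable setT (EFin \o f m).
  move=> MP; apply: integrable_ge0 => //.
    exact: (measurable_wrt_fun (@mFF m) (@f_adapted m)).
  case: m => [|m].
    have [x _] := probability_inhabited P.
    by rewrite (integral_initial idx0 P x (@f_adapted 0%N)) ltry.
  have := f_fin P m.+1 MP isT; rewrite unlock.
  by under eq_integral do rewrite ger0_norm//.
apply: (@local_regular_iff_K _ _ _ idx M P0) => //; last exact: hui.
move=> P k m x MP km.
apply: (ae_everywhere (@mFF k) (M_charges _ MP k) _ (f_super P k m MP km)) =>
  y z yz.
have [/measurable_wrt_indexP/(_ y z yz)-> _ _] :=
  condexpP (@mFF k) (M_charges _ MP k) (f_int P m MP) (f_ge0 m).
by rewrite (f_index k y z yz).
Qed.
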